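(* Let $W$ be a set of words such that in each word $\mathbf u\in W$ every adjacent (unordered) pair of occurrences (if any) of two distinct non-linear variables consists of the first occurrence in $\mathbf u$ of one of these two variables and the last occurrence in $\mathbf u$ of the other. Let $m>0$ be the maximal integer for which there is $a\in\mathfrak A$ such that $a^m$ is a subword of a word in $W$ ($m$ is infinite if there are such integers of arbitrarily large size). Then the direct product $A_0^1\times S(W)$ is finitely based if and only if either $m$ is infinite, or $m$ is finite and there is an integer $d$ with $0<d<m+1$ such that for all $b\in\mathfrak A$ and all $\mathbf T\in\mathfrak A^+$ the word $b^{m+1-d}\,\mathbf T\,b^d$ is not a subword of any word in $W$.
   Context: $\mathfrak A$ is a countable alphabet, its elements are called variables (or letters); $\mathfrak A^+$ and $\mathfrak A^*$ are the free semigroup and free monoid over $\mathfrak A$. A subword is a contiguous factor. A variable is non-linear in $\mathbf u$ if it occurs more than once in $\mathbf u$. For a set of words $W$, $S(W)$ denotes the Rees quotient of $\mathfrak A^*$ over the ideal consisting of all words that are not subwords of words in $W$; it is a monoid with zero whose nonzero elements are the subwords of words in $W$. $A_0^1$ is the monoid obtained by adjoining an identity element to the semigroup $A_0=\langle a,b\mid aa=a,\ bb=b,\ ab=0\rangle$ of order four. A semigroup is finitely based if all identities holding in it can be derived from a finite subset of them (equational logic of semigroups; monoids are regarded as semigroups). *)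

(* Defs.v *)
From HB Require Import structures.
From mathcomp Require Import all_boot.
From mathcomp Require Import boolp classical_sets functions cardinality.

Set Implicit Arguments.
Unset Strict Implicit.
Unset Printing Implicit Defensive.

Local Open Scope group_scope.

(* Free semigroup: the pair (x, s) stands for the nonempty word x :: s. *)

Definition free_semigroup (A : Type) : Type := (A * seq A)%type.

Definition word_of (A : Type) (u : free_semigroup A) : seq A := u.1 :: u.2.

Section FreeSemigroup.
Variable A : choiceType.

HB.instance Definition _ := Choice.copy (free_semigroup A) (A * seq A)%type.

Definition fsg_mul (u v : free_semigroup A) : free_semigroup A :=
  (u.1, u.2 ++ word_of v).

Lemma fsg_mulA : associative fsg_mul.
Proof. by move=> u v w; rewrite /fsg_mul /word_of /= -catA. Qed.

HB.instance Definition _ := isSemigroup.Build (free_semigroup A) fsg_mulA.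

Lemma word_ofM (u v : free_semigroup A) :
  word_of (u * v) = word_of u ++ word_of v.
Proof. by []. Qed.

Definition eval (S : semigroupType) (phi : A -> S) (u : free_semigroup A) : S :=
  foldl (fun s x => s * phi x) (phi u.1) u.2.

Lemma evalM (S : semigroupType) (phi : A -> S) :
  {morph eval phi : u v / u * v >-> u * v}.
Proof.
move=> [x s] [y t]; rewrite /eval /= foldl_cat /=; move: (foldl _ _ s) => p.
elim/last_ind: t => [//|t z IH].
by rewrite !foldl_rcons IH mulgA.
Qed.

HB.instance Definition _ (S : semigroupType) (phi : A -> S) :=
  isMultiplicative.Build (free_semigroup A) S (eval phi) (evalM phi).

End FreeSemigroup.

(* Equational logic of semigroups; the pair (u, v) is the identity u = v. *)

Definition identity (A : Type) : Type :=
  (free_semigroup A * free_semigroup A)%type.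

HB.instance Definition _ (A : choiceType) :=
  Choice.copy (identity A) (free_semigroup A * free_semigroup A)%type.

Definition holds (A : choiceType) (S : semigroupType) (e : identity A) : Prop :=
  forall phi : A -> S, eval phi e.1 = eval phi e.2.

Inductive derivable (A : choiceType) (Sigma : seq (identity A)) :
    free_semigroup A -> free_semigroup A -> Prop :=
| derivable_axiom u v : (u, v) \in Sigma -> derivable Sigma u v
| derivable_refl u : derivable Sigma u u
| derivable_sym u v : derivable Sigma u v -> derivable Sigma v u
| derivable_trans u v w :
    derivable Sigma u v -> derivable Sigma v w -> derivable Sigma u w
| derivable_mul u v u' v' :
    derivable Sigma u v -> derivable Sigma u' v' ->
    derivable Sigma (u * u') (v * v')
| derivable_subst (phi : A -> free_semigroup A) u v :
    derivable Sigma u v -> derivable Sigma (eval phi u) (eval phi v).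

Definition finitely_based (A : choiceType) (S : semigroupType) : Prop :=
  exists Sigma : seq (identity A),
    (forall e, e \in Sigma -> holds S e) /\
    (forall e, holds S e -> derivable Sigma e.1 e.2).

(* Adjoining an identity element (None) to a semigroup. *)

Definition adjoin_one (S : Type) : Type := option S.

Section AdjoinOne.
Variable S : semigroupType.

HB.instance Definition _ := Choice.copy (adjoin_one S) (option S).

Definition adjoin_one_mul (x y : adjoin_one S) : adjoin_one S :=
  match x, y with
  | None, _ => y
  | _, None => x
  | Some s, Some t => Some (s * t)
  end.

Lemma adjoin_one_mulA : associative adjoin_one_mul.
Proof. by move=> [x|] [y|] [z|] //=; rewrite mulgA. Qed.

Lemma adjoin_one_mul1 : left_id None adjoin_one_mul.
Proof. by []. Qed.

Lemma adjoin_one_mulr1 : right_id None adjoin_one_mul.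
Proof. by case. Qed.

HB.instance Definition _ := isMonoid.Build (adjoin_one S)
  adjoin_one_mulA adjoin_one_mul1 adjoin_one_mulr1.

End AdjoinOne.

(* The semigroup with zero < a, b | aa = a, bb = b, ab = 0 >: its elements are
   the normal forms a, b, ba and 0, see A0_presentation below. *)

Inductive A0 : Type := A0a | A0b | A0ba | A00.

Definition A0_code (x : A0) : bool * bool :=
  match x with
  | A0a => (true, false) | A0b => (false, true)
  | A0ba => (true, true) | A00 => (false, false)
  end.

Definition A0_decode (c : bool * bool) : A0 :=
  match c with
  | (true, false) => A0a | (false, true) => A0b
  | (true, true) => A0ba | (false, false) => A00
  end.

Lemma A0_codeK : cancel A0_code A0_decode.
Proof. by case. Qed.

HB.instance Definition _ := Finite.copy A0 (can_type A0_codeK).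

Definition A0_mul (x y : A0) : A0 :=
  match x, y with
  | A0a, A0a => A0a
  | A0b, A0b => A0b
  | A0b, A0a | A0b, A0ba | A0ba, A0a => A0ba
  | _, _ => A00
  end.

Lemma A0_mulA : associative A0_mul.
Proof. by case; case; case. Qed.

HB.instance Definition _ := isSemigroup.Build A0 A0_mulA.

Lemma card_A0 : #|{: A0}| = 4.
Proof.
have bijA0 : bijective A0_code.
  by exists A0_decode; [exact: A0_codeK | case; case; case].
by rewrite (bij_eq_card bijA0) card_prod card_bool.
Qed.

Lemma A0_relations :
  [/\ A0a * A0a = A0a, A0b * A0b = A0b, A0a * A0b = A00, A0b * A0a = A0ba
    & forall x : A0, A00 * x = A00 /\ x * A00 = A00].
Proof. by split=> //; case. Qed.

Lemma A0_presentation (S : semigroupType) (a b z : S) :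
  (forall x : S, z * x = z /\ x * z = z) ->
  a * a = a -> b * b = b -> a * b = z ->
  exists! f : A0 -> S,
    [/\ {morph f : x y / x * y >-> x * y}, f A0a = a, f A0b = b & f A00 = z].
Proof.
move=> z0 aa bb ab.
have zl x : z * x = z by case: (z0 x).
have zr x : x * z = z by case: (z0 x).
exists (fun x => match x with
  | A0a => a | A0b => b | A0ba => b * a | A00 => z end); split.
  split=> //; case; case=> //=; rewrite ?zl ?zr ?aa ?bb ?ab ?mulgA ?bb //.
  - by rewrite ab zl.
  - by rewrite -mulgA aa.
  - by rewrite -mulgA ab zr.
  - by rewrite -(mulgA b) ab zr zl.
move=> f [fM fa fb f0]; apply/funext; case=> //.
by rewrite (_ : A0ba = A0b * A0a) // fM fa fb.
Qed.

HB.instance Definition _ (A : choiceType) :=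
  isMonoid.Build (seq A) (@catA A) (@cat0s A) (@cats0 A).

(* Rees quotient of a monoid M by an ideal I: None is the class of the elements
   of I and insub : M -> rees_quotient I is the canonical projection. *)

Record ideal (M : monoidType) := Ideal {
  ideal_pred :> {pred M};
  idealMl : forall x y : M, y \in ideal_pred -> x * y \in ideal_pred;
  idealMr : forall x y : M, x \in ideal_pred -> x * y \in ideal_pred
}.

Definition rees_quotient (M : monoidType) (I : ideal M) : Type :=
  option {x : M | x \notin I}.

Section ReesQuotient.
Variables (M : monoidType) (I : ideal M).

HB.instance Definition _ :=
  Choice.copy (rees_quotient I) (option {x : M | x \notin I}).

Definition rees_one : rees_quotient I := insub (1 : M).

Definition rees_mul (x y : rees_quotient I) : rees_quotient I :=
  match x, y with
  | Some s, Some t => insub (val s * val t)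
  | _, _ => None
  end.

Lemma rees_insubM (x y : M) :
  rees_mul (insub x) (insub y) = insub (x * y).
Proof.
case: insubP => [s _ <-|]; last first.
  by rewrite negbK => Ix /=; rewrite insubN // negbK idealMr.
case: insubP => [t _ <-|] //.
by rewrite negbK => Iy /=; rewrite insubN // negbK idealMl.
Qed.

Lemma rees_ex (x : rees_quotient I) :
  x = None \/ exists s : M, x = insub s.
Proof. by case: x => [s|]; [right; exists (val s); rewrite valK|left]. Qed.

Lemma rees_mulA : associative rees_mul.
Proof.
have mulN x : rees_mul x None = None by case: x.
move=> x y z; case: (rees_ex x) => [->//|[s ->]].
case: (rees_ex y) => [->|[t ->]]; first by rewrite mulN.
case: (rees_ex z) => [->|[w ->]]; first by rewrite !mulN.
by rewrite !rees_insubM mulgA.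
Qed.

Lemma rees_mul1 : left_id rees_one rees_mul.
Proof.
move=> x; case: (rees_ex x) => [->|[s ->]]; first by case: rees_one.
by rewrite rees_insubM mul1g.
Qed.

Lemma rees_mulr1 : right_id rees_one rees_mul.
Proof.
move=> x; case: (rees_ex x) => [->//|[s ->]].
by rewrite rees_insubM mulg1.
Qed.

HB.instance Definition _ :=
  isMonoid.Build (rees_quotient I) rees_mulA rees_mul1 rees_mulr1.

End ReesQuotient.

Section Words.
Variables (A : choiceType) (W : set (seq A)).

Definition subword_in (v : seq A) : Prop := exists2 u, W u & infix v u.

Definition nonsubword : {pred seq A} := [pred v | ~~ `[< subword_in v >]].

Lemma nonsubwordMl (x y : seq A) : y \in nonsubword -> x * y \in nonsubword.
Proof.
apply: contra => /asboolP[u Wu xyu]; apply/asboolP; exists u => //.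
by apply: infix_trans xyu; apply: suffix_infix.
Qed.

Lemma nonsubwordMr (x y : seq A) : x \in nonsubword -> x * y \in nonsubword.
Proof.
apply: contra => /asboolP[u Wu xyu]; apply/asboolP; exists u => //.
by apply: infix_trans xyu; apply: prefix_infix.
Qed.

Definition nonsubword_ideal : ideal (seq A) := Ideal nonsubwordMl nonsubwordMr.

Definition SW : monoidType := rees_quotient nonsubword_ideal.

Definition nonlinear (u : seq A) (x : A) : bool := (1 < count_mem x u)%N.

(* In u = p ++ x :: q, the displayed occurrence of x is the first one in u when
   first_occ p x, and the last one in u when last_occ x q. *)
Definition first_occ (p : seq A) (x : A) : bool := x \notin p.
Definition last_occ (x : A) (q : seq A) : bool := x \notin q.

Definition adjacent_first_last (u : seq A) : Prop :=
  forall (p q : seq A) (x y : A),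
    u = p ++ x :: y :: q -> x != y -> nonlinear u x -> nonlinear u y ->
    (first_occ p x /\ last_occ y q) \/
    (last_occ x (y :: q) /\ first_occ (rcons p x) y).

Definition power_in (k : nat) : Prop := exists a : A, subword_in (nseq k a).

(* m is the maximal k such that some a^k is a subword of a word in W, with
   m = None encoding that m is infinite. *)
Definition is_max_power (m : option nat) : Prop :=
  match m with
  | Some n => (0 < n)%N /\ power_in n /\ forall k, power_in k -> (k <= n)%N
  | None => forall n, exists2 k, (n <= k)%N & power_in k
  end.

End Words.

(* Main.v *)
(* A_0^1 separates two words exactly when they differ in a subsequence of length at
   most 2, and S(W) when some substitution puts one of them, but not an equal word,
   into the factors of W. The hypothesis on W makes M = A_0^1 x S(W) satisfy
   pxyq = pyxq as soon as both x and y occur in p, or both occur in q: inside a block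
   without linear letters, only the order of a first and a last occurrence matters.

   If the condition holds, these swaps reduce an identity of M to the identities in
   one nonlinear letter x it induces: the occurrences of x are gathered blockwise into
   x^k0 s1 x^k1 ... sr x^kr. When all of them lie in a single block, the first and the
   last x may be kept apart by other letters, and their number is changed with
   x^(m+1-d) t x^d = x^(m+2-d) t x^d. Identities in one nonlinear letter always have
   a finite basis: by Higman's lemma the vectors k that are not lexicographically
   minimal in their class are generated by finitely many.

   If the condition fails, every x^i t x^j with i + j = m + 1 and i, j > 0 is an
   isoterm for M. Consider the identities x w x^m = x w x^(m+1) of M in which the
   last y_i and the first z_i alternate rigidly between the first and the last x. An
   identity of M shorter than this chain must cover some last y_i and first z_i by
   one letter, which is then linear and lies between two occurrences of the letter
   covering x, so it cannot change the number m + 1 of occurrences of x. *)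

Require Import Defs.
From HB Require Import structures.
From mathcomp Require Import all_boot zify.
From mathcomp Require Import boolp classical_sets functions cardinality.

Set Implicit Arguments.
Unset Strict Implicit.
Unset Printing Implicit Defensive.

(** * Higman's lemma *)

(** The Higman order over [<=]: some subsequence of the second word dominates the first one term by
    term. *)
Inductive emb : seq nat -> seq nat -> Prop :=
| emb_nil t : emb [::] t
| emb_skip s b t : emb s t -> emb s (b :: t)
| emb_keep a s b t : a <= b -> emb s t -> emb (a :: s) (b :: t).

Lemma embs0 s : emb s [::] -> s = [::].
Proof. by move=> e; inversion e. Qed.

(** Each new index is one where the remaining tail attains its minimum. *)
Lemma nondecreasing_subsequence (a : nat -> nat) :
  exists k : nat -> nat,
    forall i j, i < j -> k i < k j /\ a (k i) <= a (k j).
Proof.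
have tail_min n : exists k, n <= k /\ forall j, n <= j -> a k <= a j.
  have exP : exists v, `[< exists2 k, n <= k & a k = v >].
    by exists (a n); apply/asboolP; exists n.
  case: (ex_minnP exP) => v /asboolP[k nk <-] minv.
  by exists k; split=> // j nj; apply: minv; apply/asboolP; exists j.
pose next n := projT1 (cid (tail_min n)).
have nextP n : n <= next n /\ forall j, n <= j -> a (next n) <= a j.
  exact: projT2 (cid (tail_min n)).
pose k := fix k i := if i is i'.+1 then next (k i').+1 else next 0.
have kS i : k i < k i.+1 by case: (nextP (k i).+1).
have kmin i j : k i <= j -> a (k i) <= a j.
  case: i => [|i] kij; first by case: (nextP 0) => _; apply.
  by have [_] := nextP (k i).+1; apply; exact: leq_trans (kS i) kij.
exists k => i j ij; have kij : k i < k j by apply: (homo_ltn ltn_trans kS).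
by split=> //; apply: kmin; exact: ltnW.
Qed.

(** The minimal bad sequence argument of Nash-Williams. *)
Theorem higman (f : nat -> seq nat) : exists i j, i < j /\ emb (f i) (f j).
Proof.
pose bad g := forall i j, i < j -> ~ emb (g i) (g j).
apply: contrapT => nex.
have fbad : bad f by move=> i j ij eij; apply: nex; exists i, j.
(* [P l]: the finite sequence [l] begins some bad sequence. [nxt] extends such an [l] by a term of
   least size that keeps this property. *)
pose P l := exists2 g, bad g & forall i, i < size l -> g i = nth [::] l i.
have step (l : seq (seq nat)) : P l ->
    exists s, P (rcons l s) /\ forall t, P (rcons l t) -> size s <= size t.
  move=> [g gbad gl].
  have exP : exists n, `[< exists2 s, P (rcons l s) & size s = n >].
    exists (size (g (size l))); apply/asboolP; exists (g (size l)) => //.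
    exists g => // i; rewrite size_rcons ltnS nth_rcons => il.
    by case: ltngtP il => // [/gl|->].
  case: (ex_minnP exP) => n /asboolP[s Ps <-] mins.
  by exists s; split=> // t Pt; apply: mins; apply/asboolP; exists t.
pose nxt l := if pselect (P l) is left Pl then projT1 (cid (step l Pl)) else [::].
pose h := fix h n := if n is n'.+1 then rcons (h n') (nxt (h n')) else [::].
have nxtP l : P l -> P (rcons l (nxt l)) /\
    forall t, P (rcons l t) -> size (nxt l) <= size t.
  move=> Pl; rewrite /nxt; case: pselect => // Pl'.
  exact: projT2 (cid (step l Pl')).
have hP n : P (h n) by elim: n => [|n /nxtP[]//]; exists f.
have szh n : size (h n) = n by elim: n => //= n IH; rewrite size_rcons IH.
pose g n := nxt (h n).
have nthh n i : i < n -> nth [::] (h n) i = g i.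
  elim: n => // n IH; rewrite ltnS leq_eqVlt /= nth_rcons szh => /orP[/eqP->|ilt].
    by rewrite ltnn eqxx.
  by rewrite ilt IH.
have gbad : bad g.
  move=> i j ij; have [k kbad] := hP j.+1; rewrite szh => kh.
  rewrite -(@nthh j.+1 i) ?(ltnW ij)// -?(@nthh j.+1 j)//; last exact: ltnW.
  by rewrite -!kh//; [exact: kbad | exact: ltnW].
have gmin n k : bad k -> (forall i, i < n -> k i = g i) -> size (g n) <= size (k n).
  move=> kbad kg; have [_] := nxtP _ (hP n); apply.
  exists k => // i; rewrite size_rcons szh ltnS nth_rcons szh leq_eqVlt.
  by case/orP=> [/eqP->|ilt]; [rewrite ltnn eqxx | rewrite ilt nthh// kg].
have gcons n : g n = head 0 (g n) :: behead (g n).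
  case gn : (g n) => [|//]; have := gbad n n.+1 (leqnn _); rewrite gn.
  by case; exact: emb_nil.
have [k kP] := nondecreasing_subsequence (fun n => head 0 (g n)).
(* From index [k 0] on, [g] is replaced by its tails along [k]. As the deleted heads weakly
   increase, an embedding between two tails would give one between terms of [g]; so [g'] is bad, yet
   its term at [k 0] is shorter than that of [g]. *)
pose g' n := if n < k 0 then g n else behead (g (k (n - k 0))).
have kinc i j : i <= j -> k i <= k j.
  by rewrite leq_eqVlt => /orP[/eqP->//|/kP[/ltnW]].
have g'bad : bad g'.
  move=> i j ij; rewrite /g'; case: (ltnP j (k 0)) => jk.
    by rewrite (ltn_trans ij jk); exact: gbad.
  case: (ltnP i (k 0)) => ik e.
    apply: (@gbad i (k (j - k 0))); first by apply: leq_trans ik (kinc _ _ _).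
    by rewrite (gcons (k _)); exact: emb_skip.
  have ij' : i - k 0 < j - k 0 by rewrite ltn_sub2r// (leq_ltn_trans ik).
  have [kij aij] := kP _ _ ij'.
  by apply: (gbad _ _ kij); rewrite (gcons (k (i - _))) (gcons (k (j - _))); exact: emb_keep.
have := gmin (k 0) g' g'bad; rewrite /g' ltnn subnn.
rewrite [in size (g _)]gcons /= ltnn => H.
by suff: false by []; apply: H => i ->.
Qed.

(** If no finite [F] worked, members of [Z] could be chosen one after another with no earlier one
    embedding in a later one, against [higman]. *)
Lemma higman_basis (Z : seq nat -> Prop) :
  exists2 F : seq (seq nat), (forall f, f \in F -> Z f) &
    forall k, Z k -> exists2 f, f \in F & emb f k.
Proof.
apply: contrapT => nF.
have nxt (F : seq (seq nat)) : exists k, (forall f, f \in F -> Z f) ->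
    Z k /\ forall f, f \in F -> ~ emb f k.
  have [FZ|?] := pselect (forall f, f \in F -> Z f); last by exists [::].
  apply: contrapT => nk; apply: nF; exists F => // k Zk.
  apply: contrapT => nf; apply: nk; exists k => _; split=> // f fF fk.
  by apply: nf; exists f.
have {nxt}[nxt nxtP] := choice nxt.
pose h := fix h n := if n is n'.+1 then rcons (h n') (nxt (h n')) else [::].
have hZ n : forall f, f \in h n -> Z f.
  elim: n => //= n IH f; rewrite mem_rcons in_cons => /orP[/eqP->|/IH//].
  by case: (nxtP _ IH).
have [i [j [ij eij]]] := higman (fun n => nxt (h n)).
have [_ /(_ (nxt (h i)))] := nxtP _ (hZ j); apply => //.
elim: j ij {eij} => // j IH; rewrite ltnS /= mem_rcons in_cons leq_eqVlt.
by case/orP=> [/eqP->|/IH->]; rewrite ?eqxx// orbT.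
Qed.

(** * The lexicographic order on vectors of equal length *)

Fixpoint lexlt (s t : seq nat) : bool :=
  match s, t with
  | a :: s', b :: t' => (a < b) || (a == b) && lexlt s' t'
  | _, _ => false
  end.

Lemma lexlt_total s t : size s = size t -> [\/ s = t, lexlt s t | lexlt t s].
Proof.
elim: s t => [|a s IH] [|b t]//=; first by constructor 1.
case=> /IH{IH}H; case: (ltngtP a b) => [ab|ab|->].
- by constructor 2.
- by constructor 3.
case: H => [->|st|ts]; first by constructor 1.
- by constructor 2.
- by constructor 3.
Qed.

(** Induction on the length and, within it, strong induction on the first entry. *)
Lemma lexlt_ind (n : nat) (Q : seq nat -> Prop) :
  (forall k, size k = n ->
    (forall l, size l = n -> lexlt l k -> Q l) -> Q k) ->
  forall k, size k = n -> Q k.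
Proof.
elim: n Q => [|n IH] Q Qind.
  by case=> // _; apply: Qind => // -[].
suff H a k : size k = n -> Q (a :: k) by case=> // a k [/H].
elim/ltn_ind: a k => a IHa; apply: IH => k szk IHk.
apply: Qind => [|[|b l]//= [szl]]; first by rewrite /= szk.
by case/orP=> [/IHa/(_ _ szl)//|/andP[/eqP-> /(IHk _ szl)]].
Qed.

(** * Words and substitutions *)

(** Images may be empty, as an assignment into a monoid may send a letter to the identity. *)
Definition wsubst (A B : Type) (phi : A -> seq B) (u : seq A) : seq B :=
  flatten (map phi u).

Arguments wsubst : simpl never.

Section Substitution.
Variables A B : eqType.
Implicit Types (phi : A -> seq B) (u v p q : seq A).

Lemma wsubst_cat phi u v : wsubst phi (u ++ v) = wsubst phi u ++ wsubst phi v.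
Proof. by rewrite /wsubst map_cat flatten_cat. Qed.

Lemma wsubst_cons phi x u : wsubst phi (x :: u) = phi x ++ wsubst phi u.
Proof. by []. Qed.

Lemma wsubst1 phi x : wsubst phi [:: x] = phi x.
Proof. by rewrite wsubst_cons cats0. Qed.

Lemma eq_in_wsubst phi psi u :
  {in u, phi =1 psi} -> wsubst phi u = wsubst psi u.
Proof. by move=> /eq_in_map e; rewrite /wsubst e. Qed.

Lemma mem_wsubst phi u b :
  reflect (exists2 x, x \in u & b \in phi x) (b \in wsubst phi u).
Proof. exact: flatten_mapP. Qed.

Lemma wsubst_nseq phi x n :
  wsubst phi (nseq n x) = flatten (nseq n (phi x)).
Proof. by rewrite /wsubst map_nseq. Qed.

Lemma flatten_nseq_nseq (b : B) n r : flatten (nseq n (nseq r b)) = nseq (n * r) b.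
Proof. by elim: n => //= n ->; rewrite -nseqD. Qed.

End Substitution.

Lemma wsubst_filter (A : eqType) (a : pred A) (u : seq A) :
  wsubst (fun z => if a z then [:: z] else [::]) u = filter a u.
Proof. by elim: u => //= z u; rewrite wsubst_cons => ->; case: (a z). Qed.

Lemma wsubst_comp (A B C : eqType) (psi : B -> seq C) (phi : A -> seq B) u :
  wsubst psi (wsubst phi u) = wsubst (fun x => wsubst psi (phi x)) u.
Proof.
by elim: u => // x u IH; rewrite !wsubst_cons wsubst_cat IH.
Qed.

Section PairSubseq.
Variable A : eqType.
Implicit Types (u v p q : seq A) (x y z : A).

(** For [x = y] this says that [x] occurs at least twice, so nonlinearity is part of the information
    on pairs. *)
Definition occurs_before u x y : bool := subseq [:: x; y] u.

Lemma occurs_before_cons u x y z :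
  occurs_before (z :: u) x y = ((x == z) && (y \in u)) || occurs_before u x y.
Proof.
rewrite /occurs_before /=; case: eqP => //= _; rewrite sub1seq.
case: (boolP (y \in u)) => //= yu; apply/esym/negbTE.
by apply: contra yu => /mem_subseq; apply; rewrite !inE eqxx orbT.
Qed.

Lemma occurs_before_mem u x y : occurs_before u x y -> x \in u /\ y \in u.
Proof. by move/mem_subseq => s; rewrite !s// !inE eqxx ?orbT. Qed.

Lemma occurs_before_cat u v x y :
  occurs_before (u ++ v) x y =
  [|| occurs_before u x y, occurs_before v x y | (x \in u) && (y \in v)].
Proof.
elim: u => [|z u IH]; first by rewrite /= orbF.
rewrite cat_cons !occurs_before_cons IH mem_cat in_cons.
by case: (x == z); case: (y \in u); case: (y \in v); case: (x \in u);
  rewrite ?orbT ?orbF ?andbT ?andbF.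
Qed.

Lemma occurs_beforexx u x : occurs_before u x x = (1 < count_mem x u).
Proof.
elim: u => // z u IH; rewrite occurs_before_cons IH /= eq_sym.
case: eqP => /= _; last by rewrite add0n.
rewrite -has_pred1 has_count add1n ltnS.
by case: (count_mem x u) => [|[|n]].
Qed.

End PairSubseq.

Lemma occurs_before_wsubst (A B : eqType) (phi : B -> seq A) (w : seq B) x y :
  occurs_before (wsubst phi w) x y <->
  (exists2 z, z \in w & occurs_before (phi z) x y) \/
  (exists z z', [/\ occurs_before w z z', x \in phi z & y \in phi z']).
Proof.
elim: w => [|t w IH]; first by split=> // -[[]//|[z [z' []]]].
rewrite wsubst_cons occurs_before_cat; split.
  case/or3P=> [e|/IH[[z zw e]|[z [z' [e xz yz]]]]|/andP[xt /mem_wsubst[z' zw yz]]].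
  - by left; exists t; rewrite ?mem_head.
  - by left; exists z; rewrite // in_cons zw orbT.
  - by right; exists z, z'; split=> //; rewrite occurs_before_cons e orbT.
  - by right; exists t, z'; split=> //; rewrite occurs_before_cons eqxx zw.
case=> [[z]|[z [z' []]]].
  rewrite in_cons => /orP[/eqP->->//|zw e].
  by apply/or3P/Or32/IH; left; exists z.
rewrite occurs_before_cons => /orP[/andP[/eqP-> zw] xt yz|e xz yz].
  by apply/or3P/Or33; rewrite xt; apply/mem_wsubst; exists z'.
by apply/or3P/Or32/IH; right; exists z, z'.
Qed.

(* [weave x [:: k0; ...; kr] [:: s1; ...; sr]] is
   [x^k0 s1 x^k1 s2 ... sr x^kr]. *)
Fixpoint weave (A : Type) (x : A) (k : seq nat) (ss : seq (seq A)) : seq A :=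
  if k is k0 :: k' then
    nseq k0 x ++ (if ss is s :: ss' then s ++ weave x k' ss' else [::])
  else [::].

Section Weave.
Variable A : eqType.
Implicit Types (x : A) (k l f h : seq nat) (ss : seq (seq A)).

Lemma wsubst_weave (B : eqType) (phi : A -> seq B) x y k ss :
  phi x = [:: y] -> wsubst phi (weave x k ss) = weave y k (map (wsubst phi) ss).
Proof.
move=> phix; elim: k ss => //= k0 k IH [|s ss] /=.
  by rewrite !cats0 wsubst_nseq phix (flatten_nseq_nseq y _ 1) muln1.
by rewrite !wsubst_cat IH wsubst_nseq phix (flatten_nseq_nseq y _ 1) muln1.
Qed.

Lemma filter_weave (a : pred A) x k ss :
  a x -> filter a (weave x k ss) = weave x k (map (filter a) ss).
Proof.
move=> ax; elim: k ss => //= k0 k IH [|s ss] /=.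
  by rewrite !cats0; apply/all_filterP; rewrite all_nseq ax orbT.
rewrite !filter_cat IH; congr (_ ++ _).
by apply/all_filterP; rewrite all_nseq ax orbT.
Qed.

Lemma weave_rcons x k ss c s :
  size k = (size ss).+1 ->
  weave x (rcons k c) (rcons ss s) = weave x k ss ++ s ++ nseq c x.
Proof.
elim: k ss => // k0 k IH [|t ss] /= [szk].
  by case: k szk {IH} => //= _; rewrite !cats0.
by rewrite IH ?catA.
Qed.

Lemma weave_of_word x (w : seq A) :
  exists2 k, size k = (size [seq z <- w | z != x]).+1 &
    w = weave x k [seq [:: z] | z <- w & z != x].
Proof.
elim: w => [|z w [[|k0 k]//= [szk] e]]; first by exists [:: 0].
rewrite /=; case: eqVneq => [->|zx] /=; last first.
  exists (0 :: k0 :: k); first by rewrite /= szk.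
  by congr (_ :: _).
exists (k0.+1 :: k); [by rewrite /= szk | by congr (_ :: _); exact: e].
Qed.
End Weave.

(** * The identities of the direct product *)

Section Evaluation.
Local Open Scope group_scope.

Definition mprod (S : monoidType) (s : seq S) : S := foldr *%g 1 s.

Lemma eval_mprod (A : choiceType) (S : monoidType) (phi : A -> S) u :
  eval phi u = mprod (map phi (word_of u)).
Proof.
case: u => x s; rewrite /eval /word_of /=; elim: s (phi x) => /= [|y s IH] a.
  by rewrite mulg1.
by rewrite IH mulgA.
Qed.

Lemma eval_pair (A : choiceType) (S T : semigroupType) (phi : A -> S * T) u :
  eval phi u = (eval (fst \o phi) u, eval (snd \o phi) u).
Proof.
case: u => x s; rewrite /eval /=; elim/last_ind: s => [|s y IH].
  by case: (phi x).
by rewrite !foldl_rcons IH.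
Qed.

(** Records which of the generators [a] and [b] occur in a nonzero element. The identity and zero
    share a code; [A01_zero] tells them apart. *)
Definition A01_code (g : adjoin_one A0) : bool * bool :=
  if g is Some z then A0_code z else (false, false).

Definition A01_of (c : bool * bool) : adjoin_one A0 :=
  if c.1 || c.2 then Some (A0_decode c) else None.

Definition A01_zero (g : adjoin_one A0) : bool :=
  if g is Some A00 then true else false.

Definition A01_compat (g h : adjoin_one A0) : bool :=
  ~~ ((A01_code g).1 && (A01_code h).2).

(** As [ab = 0] while [ba] is a normal form, a product of nonzero factors vanishes exactly when a
    factor containing [a] precedes one containing [b]; otherwise the generators that occur determine
    it. *)
Lemma mprod_A01 (w : seq (adjoin_one A0)) :
  mprod w = if has A01_zero w || ~~ pairwise A01_compat w then Some A00
            else A01_of (has (fun g => (A01_code g).1) w,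
                         has (fun g => (A01_code g).2) w).
Proof.
elim: w => //= g w ->.
have -> : all (A01_compat g) w =
    ~~ ((A01_code g).1 && has (fun g => (A01_code g).2) w).
  elim: w => /= [|h w ->]; first by rewrite andbF.
  by rewrite /A01_compat andb_orr negb_or.
case: (has A01_zero w); first by rewrite orbT; case: g => [[]|].
case: (pairwise _ w); last by rewrite andbF orbT; case: g => [[]|].
by case: (has _ w); case: (has _ w); case: g => [[]|].
Qed.

Lemma mprod_A01_zero (w : seq (adjoin_one A0)) :
  A01_zero (mprod w) = has A01_zero w || ~~ pairwise A01_compat w.
Proof.
rewrite mprod_A01; case: ifP => // _; rewrite /A01_of.
by case: (has _ w); case: (has _ w).
Qed.

End Evaluation.

Lemma pairwise_occurs_before (A : eqType) (r : rel A) (u : seq A) :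
  reflect (forall x y, occurs_before u x y -> r x y) (pairwise r u).
Proof.
apply: (iffP idP); elim: u => //= z u IH.
  case/andP=> /allP zu /IH{}IH x y; rewrite occurs_before_cons.
  by case/orP=> [/andP[/eqP-> /zu]|/IH].
move=> H; apply/andP; split.
  by apply/allP => y yu; apply: H; rewrite occurs_before_cons eqxx yu.
by apply: IH => x y e; apply: H; rewrite occurs_before_cons e orbT.
Qed.

Section Identities.
Variables (A : choiceType) (W : set (seq A)).
Implicit Types (u v w p q : seq A) (x y z : A).

Definition pair_equiv u v : Prop :=
  u =i v /\ forall x y, occurs_before u x y = occurs_before v x y.

Definition factor_equiv u v : Prop :=
  forall phi : A -> seq A,
    subword_in W (wsubst phi u) \/ subword_in W (wsubst phi v) ->
    wsubst phi u = wsubst phi v.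

Definition equiv u v : Prop := pair_equiv u v /\ factor_equiv u v.

(** Sending [x] to zero and all else to the identity detects [x]; sending [x] to [a] and [y] to [b]
    (to [ba] when [x = y]) gives zero exactly when [xy] is a subsequence. Conversely, a product
    depends on nothing else. *)
Lemma pair_equivP (u v : free_semigroup A) :
  holds (adjoin_one A0) (u, v) <-> pair_equiv (word_of u) (word_of v).
Proof.
rewrite /holds /=; set s := word_of u; set t := word_of v; split; last first.
  move=> [uv fuv] phi; rewrite !eval_mprod -/s -/t !mprod_A01 !has_map !pairwise_map.
  rewrite !(eq_has_r uv); suff -> : forall r, pairwise r s = pairwise r t by [].
  move=> r; apply/pairwise_occurs_before/pairwise_occurs_before => H x y;
    by [rewrite -fuv; exact: H | rewrite fuv; exact: H].
move=> H; split=> [x|x y].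
  pose phi z : adjoin_one A0 := if z == x then Some A00 else None.
  have := congr1 A01_zero (H phi); rewrite !eval_mprod !mprod_A01_zero.
  rewrite !has_map !pairwise_map.
  have h w : has (preim phi A01_zero) w = (x \in w).
    rewrite -has_pred1; apply: eq_has => z /=; rewrite /phi.
    by case: (z == x).
  have p w : pairwise (relpre phi A01_compat) w.
    apply/pairwise_occurs_before => y z _ /=.
    by rewrite /phi /A01_compat; case: (y == x).
  by rewrite !h !p !orbF.
pose phi z := A01_of (z == x, z == y).
have := congr1 A01_zero (H phi); rewrite !eval_mprod !mprod_A01_zero.
rewrite !has_map !pairwise_map.
have codephi z : A01_code (phi z) = (z == x, z == y).
  by rewrite /phi; case: (z == x); case: (z == y).
have h w : has (preim phi A01_zero) w = false.
  apply/negbTE/hasPn => z _ /=; rewrite /phi.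
  by case: (z == x); case: (z == y).
have p w : pairwise (relpre phi A01_compat) w = ~~ occurs_before w x y.
  apply/pairwise_occurs_before/idP => [K|/negP K z z' e].
    by apply/negP => /K /=; rewrite /A01_compat !codephi /= !eqxx.
  rewrite /= /A01_compat !codephi /=; apply/negP => /andP[/eqP zx /eqP zy].
  by rewrite -zx -zy in K.
by rewrite !h !p !negbK.
Qed.

Lemma mprod_insub (psi : A -> seq A) u :
  mprod (map (fun x => insub (psi x) : SW W) u) = insub (wsubst psi u).
Proof.
by elim: u => //= x u ->; rewrite wsubst_cons; exact: rees_insubM.
Qed.

Lemma insub_SW_eq p q :
  ((insub p : SW W) = insub q) <->
  (subword_in W p \/ subword_in W q -> p = q).
Proof.
have inI (r : seq A) : reflect (~ subword_in W r) (r \in nonsubword_ideal W).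
  by apply: (iffP idP) => [/negP K /asboolP|K]; last by apply/negP => /asboolP.
split.
  move=> e; case=> K.
    move: e; case: insubP => [s _ <-|/negPn/inI//]; case: insubP => [t _ <- [->]//|//].
  move: e; case: (insubP _ q) => [t _ <-|/negPn/inI//]; case: insubP => [s _ <- [->]//|//].
move=> H; have [K|K] := pselect (subword_in W p \/ subword_in W q).
  by rewrite H.
by rewrite !insubN// negbK; apply/inI => L; apply: K; [right|left].
Qed.

(** A letter sent to zero annihilates both sides, since their letters agree; an assignment without
    zeros on these letters lifts to a substitution by words. *)
Lemma factor_equivP (u v : free_semigroup A) :
  word_of u =i word_of v ->
  holds (SW W) (u, v) <-> factor_equiv (word_of u) (word_of v).
Proof.
rewrite /holds /= => uv; split=> [H phi|H phi].
  have := H (fun x => insub (phi x)); rewrite !eval_mprod !mprod_insub.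
  by move/insub_SW_eq.
rewrite !eval_mprod; have [|] := boolP (has (fun x => phi x == None) (word_of u)).
  have mprodN w : has (fun x => phi x == None) w -> mprod (map phi w) = None.
    elim: w => //= x w IH /orP[/eqP->//|/IH->]; by case: (phi x).
  by move=> hu; rewrite !mprodN// -(eq_has_r uv).
move/hasPn => phiN; pose psi x := oapp val [::] (phi x).
have phiE x : x \in word_of u -> phi x = insub (psi x).
  by move/phiN; rewrite /psi; case: (phi x) => //= s _; rewrite valK.
have /eq_in_map -> : {in word_of u, phi =1 (fun x => insub (psi x))} by [].
have /eq_in_map -> : {in word_of v, phi =1 (fun x => insub (psi x))}.
  by move=> x; rewrite -uv; exact: phiE.
by rewrite !mprod_insub; apply/insub_SW_eq/H.
Qed.

(** Filling the other coordinate with the identity tests the two factors of the product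
    separately. *)
Lemma equivP (u v : free_semigroup A) :
  holds (adjoin_one A0 * SW W)%type (u, v) <-> equiv (word_of u) (word_of v).
Proof.
split=> [H|[uv fuv] phi].
  have uv : pair_equiv (word_of u) (word_of v).
    apply/pair_equivP => phi; have := H (fun x => (phi x, 1%g)).
    by rewrite !eval_pair => -[].
  split=> //; apply/(factor_equivP (proj1 uv)) => phi.
  by have := H (fun x => (1%g, phi x)); rewrite !eval_pair => -[].
rewrite /= !eval_pair; congr pair.
  by have /pair_equivP := uv; apply.
by have /(factor_equivP (proj1 uv)) := fuv; apply.
Qed.

Lemma equiv_refl u : equiv u u.
Proof. by split; [split|]. Qed.

Lemma equiv_sym u v : equiv u v -> equiv v u.
Proof.
move=> [[uv puv] fuv]; split; first by split=> // x y; rewrite puv.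
by move=> phi /or_comm /fuv.
Qed.

Lemma equiv_trans v u w : equiv u v -> equiv v w -> equiv u w.
Proof.
move=> [[uv puv] fuv] [[vw pvw] fvw]; split.
  by split=> [x|x y]; rewrite ?uv ?vw ?puv ?pvw.
move=> phi [K|K].
  by rewrite (fuv phi (or_introl K)) fvw//; left; rewrite -fuv//; left.
by rewrite -(fvw phi (or_intror K)) fuv//; right; rewrite fvw//; right.
Qed.

Lemma equiv_mem u v : equiv u v -> u =i v.
Proof. by case=> [[]]. Qed.

Lemma equiv_occurs_before u v x y :
  equiv u v -> occurs_before u x y = occurs_before v x y.
Proof. by case=> [[_ ->]]. Qed.

Lemma equiv_linear u v x :
  equiv u v -> (count_mem x u == 1) = (count_mem x v == 1).
Proof.
move=> uv; have /(_ x) := equiv_mem uv; have := equiv_occurs_before x x uv.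
rewrite !occurs_beforexx -!has_pred1 !has_count.
by case: (count_mem x u) (count_mem x v) => [|[|n]] [|[|k]].
Qed.

Lemma subword_in_infix p q : infix p q -> subword_in W q -> subword_in W p.
Proof. by move=> pq [w Ww qw]; exists w => //; exact: infix_trans qw. Qed.

Lemma subword_in_catl p q : subword_in W (p ++ q) -> subword_in W p.
Proof. by apply: subword_in_infix; exact: prefix_infix. Qed.

Lemma subword_in_catr p q : subword_in W (p ++ q) -> subword_in W q.
Proof. by apply: subword_in_infix; exact: suffix_infix. Qed.

Lemma equiv_wsubst (phi : A -> seq A) u v :
  equiv u v -> equiv (wsubst phi u) (wsubst phi v).
Proof.
move=> [[uv puv] fuv]; split; last by move=> psi; rewrite !wsubst_comp; exact: fuv.
split=> [x|x y].
  by apply/mem_wsubst/mem_wsubst => -[z zu xz]; exists z => //; rewrite ?uv// -uv.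
by apply/idP/idP => /occurs_before_wsubst H; apply/occurs_before_wsubst;
  (case: H => [[z zu e]|[z [z' [e xz yz]]]]; [left; exists z; rewrite ?uv// -uv
  | right; exists z, z'; split=> //; rewrite ?puv// -puv]).
Qed.

Lemma equiv_cat u v u' v' : equiv u v -> equiv u' v' -> equiv (u ++ u') (v ++ v').
Proof.
move=> [[uv puv] fuv] [[uv' puv'] fuv']; split.
  split=> [x|x y]; first by rewrite !mem_cat uv uv'.
  by rewrite !occurs_before_cat uv uv' puv puv'.
move=> phi; rewrite !wsubst_cat => H.
have [K K'] : wsubst phi u = wsubst phi v /\ wsubst phi u' = wsubst phi v'.
  case: H => H; split; [apply: fuv|apply: fuv'|apply: fuv|apply: fuv'];
    by [left; apply: subword_in_catl H|left; apply: subword_in_catr H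
       |right; apply: subword_in_catl H|right; apply: subword_in_catr H].
by rewrite K K'.
Qed.

Lemma equiv_context p q u v : equiv u v -> equiv (p ++ u ++ q) (p ++ v ++ q).
Proof. by move=> uv; apply/equiv_cat/equiv_cat => //; exact: equiv_refl. Qed.

Lemma equiv_filter (a : pred A) u v : equiv u v -> equiv (filter a u) (filter a v).
Proof. by rewrite -!wsubst_filter; exact: equiv_wsubst. Qed.

End Identities.

(** * Consequences of the adjacency hypothesis on [W] *)

Lemma constant_prefix (A : eqType) (a : A) (s : seq A) :
  s = nseq (size s) a \/
  exists i b s', s = nseq i a ++ b :: s' /\ b != a.
Proof.
elim: s => [|c s IH]; first by left.
have [->|ca] := eqVneq c a; last by right; exists 0, c, s.
case: IH => [e|[i [b [s' [e ba]]]]]; first by left; rewrite /= -e.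
by right; exists i.+1, b, s'; rewrite e.
Qed.

Lemma count_mem_gt1 (A : eqType) (x : A) (p q : seq A) :
  (1 < count_mem x (p ++ x :: q)) = (x \in p ++ q).
Proof.
by rewrite count_cat /= eqxx addnCA add1n ltnS -has_pred1 has_count count_cat.
Qed.

Section BlockSimple.
Variables (A : choiceType) (W : set (seq A)).
Hypothesis hW : forall u : seq A, W u -> adjacent_first_last u.
Implicit Types (u v w p q : seq A) (x y z : A).

(** The hypothesis on [W] passes to subwords: a first or last occurrence in the whole word is still
    one in the factor, and recurrence in the factor gives nonlinearity. *)
Lemma adjacent_occurrences p q a b :
  subword_in W (p ++ a :: b :: q) -> a != b ->
  a \in p ++ q -> b \in p ++ q ->
  (a \notin p /\ b \notin q) \/ (a \notin q /\ b \notin p).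
Proof.
move=> [w Ww /infixP[l [r e]]] ab apq bpq.
have {}e : w = (l ++ p) ++ a :: b :: (q ++ r) by rewrite e -!catA.
have nla : nonlinear w a.
  rewrite /nonlinear e count_mem_gt1; move: apq.
  by rewrite !(mem_cat, in_cons) => /orP[]->; rewrite ?orbT.
have nlb : nonlinear w b.
  rewrite /nonlinear e -cat_rcons count_mem_gt1; move: bpq.
  by rewrite !(mem_cat, mem_rcons, in_cons) => /orP[]->; rewrite ?orbT.
case: (hW Ww e ab nla nlb).
  rewrite /first_occ /last_occ !mem_cat !negb_or => -[/andP[_ ap] /andP[bq _]].
  by left.
rewrite /first_occ /last_occ in_cons mem_rcons in_cons !mem_cat !negb_or.
by move=> [/and3P[_ aq _] /and3P[_ _ bp]]; right.
Qed.

(** Otherwise the first change of letter in the block, from [a] to some [b], is an adjacent pair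
    whose letters both recur in the second copy, so that neither is a last occurrence. *)
Lemma repeated_factor_constant p q s a mid :
  subword_in W (p ++ (a :: s) ++ mid ++ (a :: s) ++ q) ->
  s = nseq (size s) a.
Proof.
case: (constant_prefix a s) => // -[i [b [s' [-> ba]]]] H.
set r := s' ++ mid ++ (a :: nseq i a ++ b :: s') ++ q.
have {}H : subword_in W ((p ++ nseq i a) ++ a :: b :: r).
  have K (t : seq A) : a :: nseq i a ++ t = nseq i a ++ a :: t.
    by elim: (i) => //= n ->.
  by move: H; rewrite /r -!catA /= -!catA K.
have ab : a != b by rewrite eq_sym.
have mema : a \in r by rewrite /r !mem_cat mem_head !orbT.
have memb : b \in r by rewrite /r !mem_cat in_cons mem_cat mem_head !orbT.
clearbody r.
by case: (adjacent_occurrences H ab); rewrite ?mem_cat ?mema ?memb ?orbT// => -[].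
Qed.

Lemma wsubst_nonlinear_power (phi : A -> seq A) x u :
  1 < count_mem x u -> phi x != [::] -> subword_in W (wsubst phi u) ->
  exists a, phi x = nseq (size (phi x)) a.
Proof.
rewrite -occurs_beforexx => xx phix.
have [p [q [r ->]]] : exists p q r, u = p ++ x :: q ++ x :: r.
  elim: u xx => // z u IH; rewrite occurs_before_cons.
  case/orP=> [/andP[/eqP<-]|/IH[p [q [r ->]]]]; last by exists (z :: p), q, r.
  by case/splitPr => q r; exists [::], q, r.
rewrite !(wsubst_cat, wsubst_cons); case: (phi x) phix => // a s _ H.
exists a => /=; congr (_ :: _).
exact: repeated_factor_constant H.
Qed.

(** Nonempty images of [x] and [y] are powers of letters [a] and [b]. If these differ, they meet in
    an adjacent pair while both recur on the same side, so the pair cannot consist of a first and a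
    last occurrence; if they agree, the powers commute. *)
Lemma swap_factor p q x y (phi : A -> seq A) :
  (x \in p) && (y \in p) || (x \in q) && (y \in q) ->
  subword_in W (wsubst phi (p ++ x :: y :: q)) ->
  phi x ++ phi y = phi y ++ phi x.
Proof.
have [->//|xy] := eqVneq x y.
move=> xypq H.
have [->|phix] := eqVneq (phi x) [::]; first by rewrite cats0.
have [->|phiy] := eqVneq (phi y) [::]; first by rewrite cats0.
have [a xa] : exists a, phi x = nseq (size (phi x)) a.
  apply: wsubst_nonlinear_power phix H; rewrite count_mem_gt1.
  by rewrite mem_cat in_cons; case/orP: xypq => /andP[-> _]; rewrite ?orbT.
have [b yb] : exists b, phi y = nseq (size (phi y)) b.
  apply: wsubst_nonlinear_power phiy H; rewrite -cat_rcons count_mem_gt1.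
  rewrite mem_cat mem_rcons in_cons.
  by case/orP: xypq => /andP[_ ->]; rewrite ?orbT.
have ax : a \in phi x by rewrite xa mem_nseq eqxx andbT lt0n size_eq0.
have by_ : b \in phi y by rewrite yb mem_nseq eqxx andbT lt0n size_eq0.
have [ab|ab] := eqVneq a b.
  by rewrite xa yb ab -!nseqD addnC.
have mem_phi c z r : c \in phi z -> z \in r -> c \in wsubst phi r.
  by move=> cz zr; apply/mem_wsubst; exists z.
move: H; rewrite !(wsubst_cat, wsubst_cons) xa yb.
rewrite -(prednK (_ : 0 < size (phi x))) ?lt0n ?size_eq0//.
rewrite -(prednK (_ : 0 < size (phi y))) ?lt0n ?size_eq0//.
set i := (size (phi x)).-1; set j := (size (phi y)).-1.
have -> : nseq i.+1 a = nseq i a ++ [:: a] by rewrite -(nseqD i 1) addn1.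
rewrite -!catA /= catA => H.
by case/orP: xypq => /andP[/(mem_phi _ _ _ ax) ax' /(mem_phi _ _ _ by_) by'];
  case: (adjacent_occurrences H ab); rewrite !mem_cat ?ax' ?by' ?orbT// => -[].
Qed.

(** On pairs, the [x] and [y] on the common side already form both subsequences [xy] and [yx] with
    the swapped letters. *)
Lemma equiv_swap p q x y :
  (x \in p) && (y \in p) || (x \in q) && (y \in q) ->
  equiv W (p ++ x :: y :: q) (p ++ y :: x :: q).
Proof.
move=> xypq; split; last first.
  move=> phi H; rewrite !(wsubst_cat, wsubst_cons).
  congr (_ ++ _); rewrite !catA; congr (_ ++ _); case: H => H.
    exact: swap_factor xypq H.
  apply/esym; apply: swap_factor H.
  by rewrite andbC [X in _ || X]andbC.
split=> [z|z t]; first by rewrite !mem_cat !in_cons; do ?case: (_ == _).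
rewrite !occurs_before_cat !occurs_before_cons !in_cons.
case/orP: xypq => /andP[xp yp];
case: (eqVneq z x) => [zx|zx]; case: (eqVneq z y) => [zy|zy];
  case: (eqVneq t x) => [tx|tx]; case: (eqVneq t y) => [ty|ty] //=;
  rewrite ?orbF ?orFb //;
  rewrite ?zx ?tx ?xp ?yp ?(andbT, orbT) // ?zy ?ty ?xp ?yp ?(andbT, orbT) //.
Qed.
End BlockSimple.

(** * Equational derivations *)

Section Derivations.
Variable A : choiceType.
Implicit Types (Sigma : seq (identity A)) (u v w : seq A).

(** Derivability for possibly empty words; the first alternative provides the empty word, which is
    absent from the free semigroup. *)
Definition derived Sigma u v : Prop :=
  u = v \/ exists p q : free_semigroup A,
    [/\ u = word_of p, v = word_of q & derivable Sigma p q].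

Lemma derived_refl Sigma u : derived Sigma u u.
Proof. by left. Qed.

Lemma derived_sym Sigma u v : derived Sigma u v -> derived Sigma v u.
Proof.
by case=> [->|[p [q [-> -> /derivable_sym ?]]]]; [left | right; exists q, p].
Qed.

Lemma word_of_inj : injective (@word_of A).
Proof. by move=> [x s] [y t] [-> ->]. Qed.

Lemma derived_trans v Sigma u w :
  derived Sigma u v -> derived Sigma v w -> derived Sigma u w.
Proof.
case=> [->//|[p [q [-> -> pq]]]] [<-|[q' [r [/word_of_inj<- -> qr]]]].
  by right; exists p, q.
by right; exists p, r; split=> //; exact: derivable_trans qr.
Qed.

Lemma wordP u : u = [::] \/ exists p, u = word_of p.
Proof. by case: u => [|x s]; [left | right; exists (x, s)]. Qed.

Lemma derived_cat Sigma u v u' v' :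
  derived Sigma u v -> derived Sigma u' v' -> derived Sigma (u ++ u') (v ++ v').
Proof.
move=> uv uv'; apply: (@derived_trans (v ++ u')).
  case: uv => [->|[p [q [-> -> pq]]]]; first by left.
  case: (wordP u') => [->|[r ->]]; first by rewrite !cats0; right; exists p, q.
  right; exists (p * r)%g, (q * r)%g; split=> //.
  by apply: derivable_mul => //; exact: derivable_refl.
case: uv' => [->|[p [q [-> -> pq]]]]; first by left.
case: (wordP v) => [->|[r ->]]; first by right; exists p, q.
right; exists (r * p)%g, (r * q)%g; split=> //.
by apply: derivable_mul => //; exact: derivable_refl.
Qed.

Lemma derived_context Sigma p q u v :
  derived Sigma u v -> derived Sigma (p ++ u ++ q) (p ++ v ++ q).
Proof. by move=> uv; do 2?apply: derived_cat => //; exact: derived_refl. Qed.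

Lemma word_of_eval (phi : A -> free_semigroup A) (u : free_semigroup A) :
  word_of (eval phi u) = wsubst (fun x => word_of (phi x)) (word_of u).
Proof.
case: u => x s; rewrite /eval; elim/last_ind: s => [|s y IH].
  by rewrite wsubst1.
have -> : word_of (x, rcons s y) = word_of (x, s) ++ [:: y].
  by rewrite /word_of /= cats1.
by rewrite foldl_rcons word_ofM wsubst_cat wsubst1 IH.
Qed.

Lemma equiv_derivable (W : set (seq A)) Sigma :
  (forall e, e \in Sigma -> equiv W (word_of e.1) (word_of e.2)) ->
  forall p q, derivable Sigma p q -> equiv W (word_of p) (word_of q).
Proof.
move=> SigmaW p q; elim=> {p q} [u v /SigmaW//|u|u v _|u v w _ uv _|u v u' v' _ + _|phi u v _].
- exact: equiv_refl.
- exact: equiv_sym.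
- exact: equiv_trans uv.
- exact: equiv_cat.
by move=> uv; rewrite !word_of_eval; exact: equiv_wsubst.
Qed.

Lemma equiv_derived (W : set (seq A)) Sigma u v :
  (forall e, e \in Sigma -> equiv W (word_of e.1) (word_of e.2)) ->
  derived Sigma u v -> equiv W u v.
Proof.
by move=> SigmaW [->|[p [q [-> -> /(equiv_derivable SigmaW)]]]].
Qed.

(* Identities are written over the letters 0, 1, 2, ...; as substitutions in
   semigroup identities never erase a letter, so do the instances here. *)
Definition derives_pattern Sigma (U V : seq nat) : Prop :=
  forall theta : nat -> seq A, (forall i, theta i != [::]) ->
  derived Sigma (wsubst theta U) (wsubst theta V).

(** Patterns become identities over [A] along [enc], and an assignment of words to pattern letters
    becomes a substitution on [A] through a left inverse of [enc]. *)
Lemma patterns_basis (W : set (seq A)) (enc : nat -> A)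
    (L : seq (seq nat * seq nat)) :
  injective enc ->
  (forall P, P \in L -> equiv W (map enc P.1) (map enc P.2)) ->
  exists Sigma : seq (identity A),
    (forall e, e \in Sigma -> equiv W (word_of e.1) (word_of e.2)) /\
    (forall P, P \in L -> derives_pattern Sigma P.1 P.2).
Proof.
move=> enc_inj LW.
(* The default is a trivial identity. For members of [L] it is reached only when both sides are
   empty, as [equiv] words have the same letters. *)
pose toid P : identity A :=
  if (map enc P.1, map enc P.2) is (x :: s, y :: t) then ((x, s), (y, t))
  else ((enc 0, [::]), (enc 0, [::])).
exists (map toid L); split.
  move=> _ /mapP[P /LW PW ->]; rewrite /toid.
  case: (map enc P.1) (map enc P.2) PW => [|x s] [|y t] //= _; exact: equiv_refl.
move=> [U V] UVL theta theta0 /=.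
have [dec decK] : exists dec, cancel enc dec.
  exists (fun a => if pselect (exists i, enc i = a) is left ex then projT1 (cid ex) else 0).
  move=> i; case: pselect => [ex|[]]; last by exists i.
  by apply: enc_inj; exact: (projT2 (cid ex)).
have [e|[p [q [eU eV pq]]]] : derived (map toid L) (map enc U) (map enc V).
  have := map_f toid UVL; rewrite /toid /=; have /equiv_mem := LW _ UVL.
  case: (map enc U) (map enc V) => [|x s] [|y t] //= eUV.
  - by left.
  - by have := eUV y; rewrite mem_head.
  - by have := eUV x; rewrite mem_head.
  by move=> K; right; exists (x, s), (y, t); split=> //; exact: derivable_axiom.
  by rewrite (inj_map enc_inj e); left.
have fs a : {p | word_of p = theta (dec a)}.
  by case: (theta (dec a)) (theta0 (dec a)) => // x' s' _; exists (x', s').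
pose phi a := sval (fs a).
have phiE X : wsubst (fun a => word_of (phi a)) (map enc X) = wsubst theta X.
  rewrite /wsubst -map_comp; congr flatten; apply: eq_map => i /=.
  by rewrite /phi (svalP (fs _)) decK.
right; exists (eval phi p), (eval phi q); rewrite !word_of_eval -eU -eV !phiE.
by split=> //; exact: derivable_subst.
Qed.

End Derivations.

(** * Identities in one nonlinear letter *)

Section OneNonlinearLetter.
Variables (A : choiceType) (W : set (seq A)) (enc : nat -> A).
Implicit Types (x : A) (f k l h : seq nat) (ss : seq (seq A)).

Definition nonerasing ss : bool := all (fun s => s != [::]) ss.

(** All separators are allowed, also empty ones and those containing [x], since the instances
    supplied by [emb_weave] absorb part of the context in them. *)
Definition vec_equiv k l : Prop :=
  size k = size l /\ forall x ss, size ss = (size k).-1 ->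
    equiv W (weave x k ss) (weave x l ss).

Lemma vec_equiv_refl k : vec_equiv k k.
Proof. by split=> // x ss _; exact: equiv_refl. Qed.

Lemma vec_equiv_sym k l : vec_equiv k l -> vec_equiv l k.
Proof.
by move=> [kl H]; split=> // x ss; rewrite -kl => sz; exact/equiv_sym/H.
Qed.

Lemma vec_equiv_trans l k h : vec_equiv k l -> vec_equiv l h -> vec_equiv k h.
Proof.
move=> [kl H] [lh K]; split=> [|x ss sz]; first by rewrite kl.
by apply: equiv_trans (H x ss sz) _; apply: K; rewrite -kl.
Qed.

(* The word of [k] is an instance of the word of [f] in a context; [g h] is the
   result of replacing [f] by [h] in that instance. *)
Lemma emb_weave f k : emb f k -> f != [::] ->
  exists g : seq nat -> seq nat,
    [/\ g f = k, forall h, size h = size f -> size (g h) = size k,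
        forall h, size h = size f -> lexlt h f -> lexlt (g h) k
      & forall x ss, size ss = (size k).-1 ->
        exists p ss' q, [/\ size ss' = (size f).-1,
          nonerasing ss -> nonerasing ss' &
          forall h, size h = size f ->
            weave x (g h) ss = p ++ weave x h ss' ++ q]].
Proof.
elim=> {f k} // [f c k fk IH|a f c k ac fk IH] f0.
  have [g [gf gsz glex gw]] := IH f0.
  exists (fun h => c :: g h); split.
  - by rewrite gf.
  - by move=> h hf; rewrite /= gsz.
  - by move=> h hf hlt; rewrite /= eqxx ltnn glex.
  move=> x [|s ss] /= sz.
    by move: fk f0; rewrite (size0nil (esym sz)) => /embs0->.
  have [p [ss' [q [sz' ne E]]]] := gw x ss (congr1 predn sz).
  exists (nseq c x ++ s ++ p), ss', q; split=> // [/andP[_ /ne]//|h hf].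
  by rewrite E// !catA.
have [f0'|f1] := eqVneq f [::].
  (* The instance is a single power of [x]; the surplus [c - a] and all that follows become
     context. *)
  exists (fun h => (c - a + head 0 h) :: k); split.
  - by rewrite /= subnK.
  - by [].
  - by rewrite f0' => -[|b [|? ?]]//= _; rewrite !andbF !orbF; lia.
  move=> x ss sz; exists (nseq (c - a) x), [::], (weave x (0 :: k) ss).
  rewrite f0'; split=> // -[|b [|? ?]]//= _.
  by rewrite nseqD -!catA.
have [g [gf gsz glex gw]] := IH f1.
exists (fun h => (c - a + head 0 h) :: g (behead h)); split.
- by rewrite /= subnK// gf.
- by case=> //= b h [hf]; rewrite gsz.
- case=> //= b h [hf] /orP[ba|/andP[/eqP-> /(glex _ hf) ->]].
    by apply/orP; left; lia.
  by rewrite subnK// eqxx orbT.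
move=> x [|s ss] /= sz.
  by move: fk f1; rewrite (size0nil (esym sz)) => /embs0->.
have [p [ss' [q [sz' ne E]]]] := gw x ss (congr1 predn sz).
(* The context [p] to the left of the instance of the tail joins the first separator. *)
exists (nseq (c - a) x), ((s ++ p) :: ss'), q; split.
- by rewrite /= sz'; case: (f) f1.
- by case/andP=> s0 /ne; rewrite /nonerasing /= => ->; rewrite andbT; case: (s) s0.
by case=> //= b h [hf]; rewrite E// nseqD -!catA.
Qed.

(** Letter 0 carries the exponents; the letters 1, 2, ... are linear separators. *)
Definition vec_pattern k : seq nat :=
  weave 0 k (mkseq (fun i => [:: i.+1]) (size k).-1).

Lemma vec_pattern_equiv k l :
  vec_equiv k l -> equiv W (map enc (vec_pattern k)) (map enc (vec_pattern l)).
Proof.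
move=> [kl H]; have E h : map enc (vec_pattern h) =
    weave (enc 0) h (mkseq (fun i => [:: enc i.+1]) (size h).-1).
  have -> : map enc (vec_pattern h) = wsubst (fun i => [:: enc i]) (vec_pattern h).
    by elim: (vec_pattern h) => //= i s ->.
  rewrite (@wsubst_weave _ _ _ 0 (enc 0))//; congr weave.
  by rewrite -map_comp; apply: eq_map => i.
by rewrite !E kl; apply: H; rewrite size_mkseq kl.
Qed.

Lemma vec_patternK Sigma k l x ss :
  size k = size l -> size ss = (size k).-1 -> nonerasing ss ->
  derives_pattern (A := A) Sigma (vec_pattern k) (vec_pattern l) ->
  derived Sigma (weave x k ss) (weave x l ss).
Proof.
(* The default [[:: x]] keeps the substitution nonerasing beyond the letters in use. *)
move=> kl sz ne /(_ (fun i => if i is j.+1 then nth [:: x] ss j else [:: x])).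
set theta := fun i => _; have E h : size h = size k -> wsubst theta (vec_pattern h) = weave x h ss.
  move=> hk; rewrite (@wsubst_weave _ _ _ 0 x)//; congr weave.
  rewrite -map_comp hk -sz -[RHS](mkseq_nth [:: x]).
  by apply: eq_map => i; rewrite /= wsubst1.
rewrite !E//; apply=> -[|j] //=.
have [jss|jss] := ltnP j (size ss); last by rewrite nth_default.
exact: (all_nthP _ ne).
Qed.

(* Every vector reduces to the lexicographically least one in its class: by
   Higman's lemma, finitely many reductions f -> f' suffice, since the reducible
   vectors are closed upward under embedding. *)
Lemma vec_basis :
  exists L : seq (seq nat * seq nat),
    (forall P, P \in L -> equiv W (map enc P.1) (map enc P.2)) /\
    forall Sigma, (forall P, P \in L -> derives_pattern (A := A) Sigma P.1 P.2) ->
      forall k l, vec_equiv k l -> forall x ss, size ss = (size k).-1 ->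
        nonerasing ss -> derived Sigma (weave x k ss) (weave x l ss).
Proof.
pose red f := exists2 f', vec_equiv f f' & lexlt f' f.
have [F Fred Femb] := higman_basis red.
have /choice[g gP] f : exists f', red f -> vec_equiv f f' /\ lexlt f' f.
  have [[f' ff' lt]|nred] := pselect (red f).
    by exists f'.
  by exists [::].
exists [seq (vec_pattern f, vec_pattern (g f)) | f <- F]; split.
  by move=> _ /mapP[f /Fred/gP[e _] ->]; exact: vec_pattern_equiv.
move=> Sigma HSigma.
pose der k l := forall x ss, size ss = (size k).-1 ->
        nonerasing ss -> derived Sigma (weave x k ss) (weave x l ss).
have step k : red k -> exists l, [/\ vec_equiv k l, lexlt l k & der k l].
  move=> kred; have [f fF fk] := Femb k kred.
  have [[szf ff'] lt] := gP f (Fred f fF).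
  have f0 : f != [::] by case: (f) lt => //; case: (g _).
  have [h [hf hsz hlex hw]] := emb_weave fk f0.
  exists (h (g f)); split.
  - split=> [|x ss sz]; first by rewrite hsz.
    have [p [ss' [q [sz' ne E]]]] := hw x ss sz.
    by rewrite -{1}hf !E//; apply/equiv_context/ff'.
  - exact: hlex.
  move=> x ss sz ss0; have [p [ss' [q [sz' ne E]]]] := hw x ss sz.
  rewrite -{1}hf !E//; apply/derived_context/vec_patternK => //; first exact: ne.
  by apply: (HSigma (_, _)); apply/mapP; exists f.
have min n k : size k = n -> exists l, [/\ vec_equiv k l, ~ red l & der k l].
  move: k; apply: lexlt_ind => k szk IH.
  have [/step[l [kl lk dkl]]|nred] := pselect (red k); last first.
    exists k; split=> [||x ss _ _]; [exact: vec_equiv_refl | exact: nred |].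
    exact: derived_refl.
  have [|l' [ll' nl' dl']] := IH l _ lk; first by rewrite -(proj1 kl).
  exists l'; split=> //; first exact: vec_equiv_trans ll'.
  move=> x ss sz ss0; apply: derived_trans (dkl x ss sz ss0) _.
  by apply: dl'; rewrite -?(proj1 kl).
move=> k l kl x ss sz ss0.
have [k' [kk' nk' dk']] := min _ k erefl.
have [l' [ll' nl' dl']] := min _ l erefl.
have kl' : vec_equiv k' l'.
  by apply: vec_equiv_trans (vec_equiv_sym kk') _; exact: vec_equiv_trans ll'.
(* Distinct equivalent vectors are comparable, and the larger one would be reducible. *)
have e : k' = l'.
  case: (lexlt_total (proj1 kl')) => // lt; first by case: nl'; exists k' => //; exact: vec_equiv_sym.
  by case: nk'; exists l'.
apply: derived_trans (dk' x ss sz ss0) _; rewrite e; apply: derived_sym.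
by apply: dl'; rewrite -?(proj1 kl).
Qed.

End OneNonlinearLetter.

Lemma filter_pred1 (A : eqType) (x : A) (u : seq A) :
  filter (pred1 x) u = nseq (count_mem x u) x.
Proof. by elim: u => //= z u ->; case: eqP => [->|]. Qed.

Lemma filter_neq_weave (A : eqType) (x : A) k ss :
  size k = (size ss).+1 ->
  filter (predC1 x) (weave x k ss) = filter (predC1 x) (flatten ss).
Proof.
have fx i : filter (predC1 x) (nseq i x) = [::].
  by elim: i => //= i ->; rewrite eqxx.
elim: k ss => // k0 k IH [|s ss] /= [szk]; first by rewrite cats0 fx.
by rewrite !filter_cat IH// fx.
Qed.

Lemma first_split (A : eqType) (x : A) (u : seq A) :
  x \in u -> exists p q, u = p ++ x :: q /\ x \notin p.
Proof.
elim: u => // z u IH; rewrite in_cons; case: eqVneq => [<- _|xz /IH[p [q [-> xp]]]].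
  by exists [::], u.
by exists (z :: p), q; rewrite in_cons negb_or xz.
Qed.

Lemma last_split (A : eqType) (x : A) (u : seq A) :
  x \in u -> exists p q, u = p ++ x :: q /\ x \notin q.
Proof.
rewrite -mem_rev => /first_split[p [q [e xp]]].
exists (rev q), (rev p); rewrite mem_rev; split=> //.
by rewrite -[u]revK e rev_cat rev_cons cat_rcons.
Qed.

Lemma first_last_split (A : eqType) (x : A) (u : seq A) :
  1 < count_mem x u ->
  exists p r q, [/\ u = p ++ x :: r ++ x :: q, x \notin p & x \notin q].
Proof.
move=> xu; have : x \in u by rewrite -has_pred1 has_count (ltn_trans _ xu).
case/first_split => p [v [eu xp]].
move: xu; rewrite eu count_mem_gt1 mem_cat (negbTE xp) => /last_split[r [q [-> xq]]].
by exists p, r, q.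
Qed.

(** * Reduction to one nonlinear letter *)

Section Normalization.
Variables (A : choiceType) (W : set (seq A)) (Sigma : seq (identity A)).
Implicit Types (u v p q : seq A) (x y z : A).
Hypothesis Sigma_sound :
  forall e, e \in Sigma -> equiv W (word_of e.1) (word_of e.2).
Hypothesis derived_swap : forall p q x y,
  (x \in p) && (y \in p) || (x \in q) && (y \in q) ->
  derived Sigma (p ++ x :: y :: q) (p ++ y :: x :: q).

Variable U : seq A.

(** Linearity is read off the fixed word [U]; as [equiv] preserves it, it is the same in every word
    equivalent to [U]. *)
Definition lin z : bool := count_mem z U == 1.
Definition mark x : pred A := fun z => (z == x) || lin z.

Lemma equivU_derived u v :
  equiv W u U -> derived Sigma u v -> equiv W v U.
Proof.
by move=> uU /(equiv_derived Sigma_sound) uv; apply: equiv_trans uU; exact: equiv_sym.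
Qed.

Lemma mem_nonlin p q z : equiv W (p ++ z :: q) U -> ~~ lin z -> z \in p ++ q.
Proof.
move=> e; rewrite /lin -(equiv_linear z e) -count_mem_gt1.
have : 0 < count_mem z (p ++ z :: q).
  by rewrite -has_count has_pred1 mem_cat mem_head orbT.
by case: (count_mem z _) => [|[|n]].
Qed.

(** The letter [z] moves left through [s] one swap at a time; the condition is that of
    [derived_swap] when [z] meets [y]. *)
Lemma derived_move p s q z :
  (forall s1 y s2, s = s1 ++ y :: s2 ->
    (y \in p ++ s1) && (z \in p ++ s1) || (y \in s2 ++ q) && (z \in s2 ++ q)) ->
  derived Sigma (p ++ s ++ z :: q) (p ++ z :: s ++ q).
Proof.
elim/last_ind: s q => [|s y IH] q cond; first exact: derived_refl.
rewrite -!cats1 -!catA /= ; apply: (@derived_trans _ (p ++ s ++ z :: y :: q)).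
  rewrite !(catA p); apply: derived_swap.
  by apply: (cond s y [::]); rewrite cats1.
apply: IH => s1 t s2 e.
by have := cond s1 t (rcons s2 y); rewrite e rcons_cat cat_rcons; apply.
Qed.

(** With [x] on both sides, another occurrence of a nonlinear letter always shares its side with
    some [x], so every swap is allowed. *)
Lemma derived_move_inner p s q i x :
  equiv W (p ++ s ++ nseq i x ++ q) U -> {in s, forall z, ~~ lin z} ->
  x \in p -> x \in q ->
  derived Sigma (p ++ s ++ nseq i x ++ q) (p ++ nseq i x ++ s ++ q).
Proof.
move=> + sl xp xq; elim: i p xp => [|i IH] p xp eU; first exact: derived_refl.
have D : derived Sigma (p ++ s ++ x :: nseq i x ++ q) (p ++ x :: s ++ nseq i x ++ q).
  apply: derived_move => s1 y s2 es.
  rewrite !mem_cat.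
  rewrite xp xq !orbT !andbT.
  have [->|yx] := eqVneq y x; first by rewrite xp.
  have: y \in p ++ s1 ++ s2 ++ nseq i.+1 x ++ q.
    rewrite catA; apply: (mem_nonlin (z := y)); last by apply: sl; rewrite es mem_cat mem_head orbT.
    by move: eU; rewrite es -!catA.
  rewrite !mem_cat !mem_nseq (negbTE yx) andbF /=.
  by case/or4P=> ->; rewrite ?orbT.
apply: (derived_trans D _); rewrite /= -!(cat_rcons x p).
apply: IH; first by rewrite mem_rcons mem_head.
by rewrite cat_rcons; apply: equivU_derived D.
Qed.

Lemma filter_head_nil (a : pred A) p q r z :
  filter a (p ++ z :: q) = filter a (z :: r) -> a z -> z \notin p ->
  filter a p = [::].
Proof.
rewrite filter_cat /= => + az; rewrite az.
case E : (filter a p) => [//|y s] [yz _] zp; move: zp.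
have : y \in filter a p by rewrite E mem_head.
by rewrite mem_filter yz => /andP[_ ->].
Qed.

(** Induction on [v] brings its first letter [z] to the front of [u]. By agreement of the
    projections, only nonlinear letters precede the first [z] in [u], and none does if [z] is
    linear. *)
Lemma derived_of_marks v c u :
  equiv W (c ++ u) U -> equiv W (c ++ v) U ->
  (forall x, filter (mark x) (c ++ u) = filter (mark x) (c ++ v)) ->
  derived Sigma (c ++ u) (c ++ v).
Proof.
elim: v c u => [|z v IH] c u uU vU agree.
  case: u agree uU => [|z u] agree _; first exact: derived_refl.
  have /(congr1 size) := agree z; rewrite cats0 filter_cat /= /mark eqxx /=.
  by rewrite size_cat /= => /eqP; rewrite -[X in _ == X]addn0 eqn_add2l.
have {}agree x : filter (mark x) u = filter (mark x) (z :: v).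
  by have := agree x; rewrite !filter_cat => /eqP; rewrite eqseq_cat// eqxx => /eqP.
have markxx x : mark x x by rewrite /mark eqxx.
have zu : z \in u.
  have : z \in filter (mark z) u by rewrite agree /= markxx mem_head.
  by rewrite mem_filter => /andP[].
have cnt x : count_mem x u = count_mem x (z :: v).
  have E s : count_mem x s = count_mem x (filter (mark x) s).
    rewrite count_filter; apply: eq_count => y /=.
    by rewrite /mark; case: eqP.
  by rewrite E agree -E.
have [p [q [eu zp]]] : exists p q, u = p ++ z :: q /\ z \notin p.
  by apply: first_split.
subst u.
have markp x : mark x z -> filter (mark x) p = [::].
  by move=> xz; apply: filter_head_nil (agree x) xz zp.
have pmark x : mark x z -> x \notin p.
  move=> /markp xp; apply/negP => xinp.
  by have : x \in filter (mark x) p by [rewrite mem_filter markxx]; rewrite xp.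
have D : derived Sigma (c ++ p ++ z :: q) (c ++ z :: p ++ q).
  apply: derived_move => p1 y p2 ep.
  have yp : y \in p by rewrite ep mem_cat mem_head orbT.
  have yz : y != z by apply: contraNneq zp => <-.
  have nly : ~~ lin y.
    apply/negP => ly; have : y \in filter (mark z) p by rewrite mem_filter /mark ly orbT.
    by rewrite markp// markxx.
  have nlz : ~~ lin z.
    by apply/negP => lz; have := pmark y; rewrite /mark lz orbT yp => /(_ isT).
  have yv : y \in v.
    have : y \in z :: v by rewrite -has_pred1 has_count -cnt -has_count has_pred1 mem_cat yp.
    by rewrite in_cons (negbTE yz).
  have y12 : (y \in c ++ p1) || (y \in p2 ++ q).
    have : y \in (c ++ p1) ++ p2 ++ z :: q.
      by apply: (mem_nonlin (z := y)) nly; move: uU; rewrite ep -!catA.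
    by rewrite !mem_cat in_cons (negbTE yz) /= -!orbA.
  have z12 : (z \in c ++ p1) || (z \in p2 ++ q).
    have : z \in (c ++ p) ++ q by apply: (mem_nonlin (z := z)) nlz; rewrite -catA.
    by rewrite !mem_cat (negbTE zp) orbF => /orP[] ->; rewrite ?orbT.
  have zp1 : z \notin p1 by apply: contra zp; rewrite ep mem_cat => ->.
  have zp2 : z \notin p2 by apply: contra zp; rewrite ep mem_cat in_cons => ->; rewrite !orbT.
  have ob s t : occurs_before (c ++ p ++ z :: q) s t = occurs_before (c ++ z :: v) s t.
    by rewrite (equiv_occurs_before _ _ uU) (equiv_occurs_before _ _ vU).
  apply: contraPT (y12) => ncond _.
  (* A blocked swap involves the last [y] and the first [z], or the first [y] and the last [z]. Then
     [zy] is a subsequence on the side of [v] only, or [yz] on the side of [u] only. *)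
  have [[y2 z1]|[y1 z2]] : (y \notin p2 ++ q /\ z \notin c ++ p1) \/
      (y \notin c ++ p1 /\ z \notin p2 ++ q).
    by move: y12 z12 ncond; do 4!case: (_ \in _) => //=; auto.
  - have := ob z y; rewrite [RHS]occurs_before_cat occurs_before_cons eqxx yv /= orbT.
    move: y2 z1; rewrite !mem_cat !negb_or => /andP[yp2 yq] /andP[zc _].
    rewrite occurs_before_cat (negbTE zc) /= orbF.
    rewrite occurs_before_cat (negbTE zp) /= orbF occurs_before_cons eqxx (negbTE yq) /=.
    by case/or3P=> /occurs_before_mem[]; rewrite ?(negbTE zc) ?(negbTE zp) ?(negbTE yq).
  have := ob y z; rewrite catA [LHS]occurs_before_cat mem_cat yp mem_head !orbT.
  move: y1 z2; rewrite !mem_cat !negb_or => /andP[yc _] /andP[_ zq].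
  rewrite occurs_before_cat (negbTE yc) /= orbF occurs_before_cons (negbTE yz) /=.
  have zv : z \notin v.
    have := cnt z; rewrite count_cat /= eqxx.
    have -> : count_mem z p = 0 by apply/count_memPn.
    have -> : count_mem z q = 0 by apply/count_memPn.
    by rewrite add0n addn0 => -[/esym/count_memPn].
  by move=> /esym/orP[] /occurs_before_mem[]; rewrite ?(negbTE yc) ?(negbTE zv).
apply: (derived_trans D _); rewrite -!(cat_rcons z c); apply: IH.
- by rewrite cat_rcons; exact: equivU_derived D.
- by rewrite cat_rcons.
move=> x; rewrite !cat_rcons !filter_cat; congr (_ ++ _).
rewrite -agree filter_cat /= filter_cat.
by case: ifP => // xz; rewrite markp.
Qed.

Lemma derived_move_innerR p s q i x :
  equiv W (p ++ nseq i x ++ s ++ q) U -> {in s, forall z, ~~ lin z} ->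
  x \in p -> x \in q ->
  derived Sigma (p ++ nseq i x ++ s ++ q) (p ++ s ++ nseq i x ++ q).
Proof.
elim: s p => [|z s IH] p eU sl xp xq; first exact: derived_refl.
have D : derived Sigma (p ++ nseq i x ++ z :: s ++ q) (p ++ z :: nseq i x ++ s ++ q).
  apply: derived_move => s1 y s2 es.
  have -> : y = x.
    have : y \in nseq i x by rewrite es mem_cat mem_head orbT.
    by rewrite mem_nseq => /andP[_ /eqP].
  have : z \in (p ++ nseq i x) ++ s ++ q.
    by apply: mem_nonlin (sl z (mem_head _ _)); rewrite -catA.
  rewrite !mem_cat mem_nseq xp xq !orbT /= -orbA => /or4P[->|/andP[_ /eqP->]|->|->];
    by rewrite ?xp ?orbT.
apply: (derived_trans D); rewrite /= -!(cat_rcons z p).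
apply: IH => //; last by rewrite mem_rcons in_cons xp orbT.
- by rewrite cat_rcons; exact: equivU_derived D.
by move=> t ts; apply: sl; rewrite in_cons ts orbT.
Qed.

Lemma weave_last x (k : seq nat) (c : nat) (ss : seq (seq A)) :
  size k = size ss -> weave x (rcons k c.+1) ss = weave x (rcons k c) ss ++ [:: x].
Proof.
elim: k ss => [|k0 k IH] [|s ss]//= => [_|[szk]]; last by rewrite IH// -!catA.
by rewrite !cats0 -[RHS](nseqD c 1) addn1.
Qed.

(** Scanning [r] from the left, [s] collects the nonlinear letters other than [x] since the last
    linear letter. An [x] moves left past [s] to the preceding power; a linear letter closes [s]
    into a separator. *)
Lemma gather_left p r q x :
  equiv W (p ++ r ++ q) U -> ~~ lin x -> x \in p -> x \in q ->
  exists k ss s, [/\ size k = (size ss).+1, nonerasing ss,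
    {in s, forall z, ~~ lin z} /\ flatten ss ++ s = filter (predC1 x) r,
    map (filter lin) ss = [seq [:: t] | t <- filter lin r] &
    derived Sigma (p ++ r ++ q) (p ++ weave x k ss ++ s ++ q)].
Proof.
move=> + xl xp; elim/last_ind: r q => [|r z IH] q eU xq.
  by exists [:: 0], [::], [::]; split=> //; exact: derived_refl.
rewrite cat_rcons in eU *; have xzq : x \in z :: q by rewrite in_cons xq orbT.
have [k [ss [s [szk ne [sl fl] fs D]]]] := IH _ eU xzq.
have eU' := equivU_derived eU D.
have [zx|zx] := eqVneq z x.
  subst z; case/lastP: k szk D eU' => // k c; rewrite size_rcons => -[szk] D eU'.
  exists (rcons k c.+1), ss, s; split=> //.
  - by rewrite size_rcons szk.
  - by rewrite filter_rcons /= eqxx.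
  - by rewrite filter_rcons (negbTE xl).
  apply: (derived_trans D); rewrite weave_last// -catA.
  have := @derived_move_inner (p ++ weave x (rcons k c) ss) s q 1 x.
  rewrite -!catA /=; apply=> //.
  by rewrite mem_cat xp.
have fr : filter (predC1 x) (rcons r z) = rcons (filter (predC1 x) r) z.
  by rewrite filter_rcons /= zx.
have [zl|zl] := boolP (lin z).
  exists (rcons k 0), (rcons ss (rcons s z)), [::]; split.
  - by rewrite !size_rcons szk.
  - by rewrite /nonerasing all_rcons -size_eq0 size_rcons.
  - by split=> //; rewrite fr -fl cats0 -cats1 flatten_cat /= cats0 -rcons_cat.
  - rewrite map_rcons filter_rcons zl map_rcons fs filter_rcons zl; congr rcons.
    by have /eq_in_filter -> : {in s, lin =1 pred0} by [move=> t /sl/negbTE]; rewrite filter_pred0.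
  by rewrite weave_rcons// cats0 -!catA cat_rcons.
exists k, ss, (rcons s z); split=> //.
- split; last by rewrite fr -fl rcons_cat.
  by move=> t; rewrite mem_rcons in_cons => /orP[/eqP->//|/sl].
- by rewrite filter_rcons (negbTE zl).
by rewrite cat_rcons.
Qed.

(** The remainder [s] left by [gather_left] joins the last separator, and the final power of [x]
    moves right past it; a linear letter in [r] ensures that this separator exists. Each separator
    then has exactly one linear letter. *)
Lemma gather p r q x :
  equiv W (p ++ x :: r ++ x :: q) U -> ~~ lin x -> has lin r ->
  exists k ss, [/\ size k = (size ss).+1, nonerasing ss,
    flatten ss = filter (predC1 x) r,
    map (filter lin) ss = [seq [:: t] | t <- filter lin r] &
    derived Sigma (p ++ x :: r ++ x :: q) (p ++ weave x k ss ++ q)].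
Proof.
move=> eU xl rl; have eU1 : equiv W (rcons p x ++ r ++ x :: q) U by rewrite cat_rcons.
have [||k [ss [s [szk ne [sl fl] fs D]]]] := gather_left eU1 xl.
- by rewrite mem_rcons mem_head.
- exact: mem_head.
have := congr1 size fs; rewrite !size_map size_filter.
case/lastP: ss szk ne fl fs D => [|ss t]; first by move=> _ _ _ _ _ /esym/eqP; rewrite -leqn0 leqNgt -has_count rl.
rewrite size_rcons; case/lastP: k => // k c; rewrite size_rcons => -[szk] ne fl fs D _.
have [k0 [k' ek]] : exists k0 k', k = k0 :: k' by case: k szk {D} => // k0 k' _; exists k0, k'.
(* The two outer [x] account for the increments. *)
exists (k0.+1 :: rcons k' c.+1), (rcons ss (t ++ s)); split.
- by rewrite /= !size_rcons -szk ek.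
- move: ne; rewrite /nonerasing !all_rcons => /andP[t0 ->].
  by case: (t) t0.
- by rewrite -fl -!cats1 !flatten_cat /= !cats0 catA.
- rewrite -fs !map_rcons filter_cat; congr rcons.
  by have /eq_in_filter -> : {in s, lin =1 pred0} by [move=> z /sl/negbTE]; rewrite filter_pred0 cats0.
have eU2 := equivU_derived eU1 D.
rewrite -cat_rcons; apply: (derived_trans D).
have -> : weave x (k0.+1 :: rcons k' c.+1) (rcons ss (t ++ s)) =
    x :: weave x k ss ++ t ++ s ++ nseq c x ++ [:: x].
  rewrite -[LHS]/(x :: weave x (rcons (k0 :: k') c.+1) (rcons ss (t ++ s))).
  by rewrite -ek weave_rcons// -(nseqD c 1) addn1 -!catA.
move: eU2; rewrite weave_rcons// !cat_rcons !cat_cons -!catA /= => eU2.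
have := @derived_move_innerR (p ++ x :: weave x k ss ++ t) s (x :: q) c x.
rewrite -!catA !cat_cons -!catA; apply=> //; last by rewrite mem_head.
by rewrite mem_cat mem_head orbT.
Qed.

(** All inner [x] are gathered on the left; then any part of this power may go to the right end. *)
Lemma gather_block p r q x i j :
  equiv W (p ++ r ++ q) U -> {in r, forall z, ~~ lin z} ->
  x \in p -> x \in q -> i + j = count_mem x r ->
  derived Sigma (p ++ r ++ q)
    (p ++ nseq i x ++ filter (predC1 x) r ++ nseq j x ++ q).
Proof.
move=> eU rl xp xq ij.
have D : derived Sigma (p ++ r ++ q)
    (p ++ nseq (i + j) x ++ filter (predC1 x) r ++ q).
  rewrite ij {ij}; elim: r p eU rl xp => [|z r IH] p eU rl xp; first exact: derived_refl.
  have rl' : {in r, forall z, ~~ lin z} by move=> t tr; apply: rl; rewrite in_cons tr orbT.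
  have D := IH (rcons p z) _ rl' _.
  rewrite !cat_rcons mem_rcons in_cons xp orbT in D.
  have {}D := D eU isT; apply: (derived_trans D).
  rewrite /=; case: eqVneq => [->|zx] /=; first exact: derived_refl.
  rewrite add0n.
  have := @derived_move_inner p [:: z] (filter (predC1 x) r ++ q) (count_mem x r) x.
  apply=> //; first exact: equivU_derived D.
    by move=> t; rewrite inE => /eqP->; apply: rl; rewrite mem_head.
  by rewrite mem_cat xq orbT.
apply: (derived_trans D); rewrite nseqD -!catA !(catA p).
apply: derived_move_innerR => //.
- by have := equivU_derived eU D; rewrite nseqD -!catA.
- by move=> t; rewrite mem_filter => /andP[_ /rl].
by rewrite mem_cat xp.
Qed.

(** Distinct one-letter separators are generic: arbitrary words can be substituted for them. *)
Lemma vec_equivI x (T : seq A) k l :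
  uniq T -> x \notin T -> size k = (size T).+1 -> size k = size l ->
  equiv W (weave x k [seq [:: t] | t <- T]) (weave x l [seq [:: t] | t <- T]) ->
  vec_equiv W k l.
Proof.
move=> uT xT szk kl E; split=> // y ss; rewrite szk /= => szss.
pose psi z := if z == x then [:: y] else nth [::] ss (index z T).
have := equiv_wsubst psi E.
have psix : psi x = [:: y] by rewrite /psi eqxx.
rewrite !(wsubst_weave _ _ psix).
suff -> : map (wsubst psi) [seq [:: t] | t <- T] = ss by [].
rewrite -map_comp; apply: (@eq_from_nth _ [::]); first by rewrite size_map.
move=> i; rewrite size_map => iT; rewrite (nth_map x)//= wsubst1 /psi index_uniq//.
by case: eqP => // e; rewrite -e mem_nth in xT.
Qed.

Lemma uniq_occurs_before_eq (s t : seq A) :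
  uniq s -> uniq t -> pair_equiv s t -> s = t.
Proof.
elim: s t => [|x s IH] [|y t]// us ut [st ob].
- by have := st y; rewrite mem_head.
- by have := st x; rewrite mem_head.
have xy : x = y.
  apply/eqP; apply: contraT => xy.
  have ys : y \in s by have := st y; rewrite mem_head in_cons eq_sym (negbTE xy).
  have := ob x y; rewrite !occurs_before_cons eqxx ys /= (negbTE xy) /=.
  move/esym/occurs_before_mem => [_ yt].
  by move: ut; rewrite /= yt.
subst y; move: us ut => /= /andP[xs us] /andP[xt ut]; congr (_ :: _); apply: IH => //.
split=> [z|y z].
  have := st z; rewrite !in_cons; case: eqP => //= -> _.
  by rewrite (negbTE xs) (negbTE xt).
have := ob y z; rewrite !occurs_before_cons; case: eqP => //= -> _.
have nx r : x \notin r -> occurs_before r x z = false.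
  by move=> xr; apply/negP => /occurs_before_mem[]; rewrite (negbTE xr).
by rewrite !nx.
Qed.

Lemma uniq_filter_lin u : equiv W u U -> uniq (filter lin u).
Proof.
move=> uU; rewrite uniq_pairwise; apply/pairwise_occurs_before => x y e /=.
apply/eqP => xy; subst y; have [] := occurs_before_mem e; rewrite mem_filter => /andP[xl _] _.
move: e; rewrite occurs_beforexx count_filter.
rewrite (eq_count (a2 := pred1 x)) => [|z /=]; last by case: eqP => // ->.
by move: xl; rewrite /lin -(equiv_linear x uU) => /eqP->.
Qed.

Lemma filter_lin_eq u v : equiv W u U -> equiv W v U -> filter lin u = filter lin v.
Proof.
move=> uU vU; apply: uniq_occurs_before_eq; try exact: uniq_filter_lin.
have /(equiv_filter lin)[//] : equiv W u v.
by apply: equiv_trans uU _; exact: equiv_sym.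
Qed.

(** Whether a linear [z] lies in [p], [r] or [q] is decided by which of [xz] and [zx] are
    subsequences, so equivalent words place their linear letters alike around the first and last
    [x]. *)
Lemma lin_parts p r q x :
  equiv W (p ++ x :: r ++ x :: q) U -> x \notin p -> x \notin q -> ~~ lin x ->
  let u := p ++ x :: r ++ x :: q in
  [/\ filter lin p = [seq z <- filter lin u | ~~ occurs_before u x z],
      filter lin q = [seq z <- filter lin u | ~~ occurs_before u z x]
    & filter lin r = [seq z <- filter lin u | occurs_before u x z && occurs_before u z x]].
Proof.
move=> uU xp xq xl u.
have zx z : lin z -> (z == x) = false by move=> zl; apply: contraNF xl => /eqP<-.
have nob s y z : (y \notin s) || (z \notin s) -> occurs_before s y z = false.
  by move=> H; apply: contraTF H => /occurs_before_mem[-> ->].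
have obx z : lin z -> occurs_before u x z = (z \in r) || (z \in q).
  move=> zl; rewrite /u occurs_before_cat (negbTE xp) orbF nob ?xp//=.
  have mc : (z \in r ++ x :: q) = (z \in r) || (z \in q).
    by rewrite mem_cat in_cons zx.
  rewrite occurs_before_cons eqxx mc /=; apply: orb_idr.
  by move=> /occurs_before_mem[_ H]; rewrite -mc; exact: H.
have oxb z : lin z -> occurs_before u z x = (z \in p) || (z \in r).
  move=> zl; rewrite /u -cat_cons catA occurs_before_cat mem_head andbT.
  have mc : (z \in p ++ x :: r) = (z \in p) || (z \in r).
    by rewrite mem_cat in_cons zx.
  rewrite occurs_before_cons zx// (nob q) ?xq ?orbT//= mc.
  by apply: orb_idl => /occurs_before_mem[H _]; rewrite -mc; exact: H.
have dis z : lin z -> [&& (z \in p) ==> (z \notin r) && (z \notin q),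
    (z \in r) ==> (z \notin p) && (z \notin q) &
    (z \in q) ==> (z \notin p) && (z \notin r)].
  move=> zl; have : count_mem z u == 1 by rewrite (equiv_linear z uU).
  rewrite /u count_cat /= count_cat /= [x == z]eq_sym zx// -!has_pred1 !has_count.
  by move: (count_mem z p) (count_mem z r) (count_mem z q) => [|i] [|j] [|k]; lia.
have parts (a : pred A) : filter a (filter lin u) =
    filter (predI a lin) p ++ filter (predI a lin) r ++ filter (predI a lin) q.
  rewrite -filter_predI /u !filter_cat /= !filter_cat /=.
  by rewrite (negbTE xl) !andbF.
have keep (a b : pred A) s : (forall z, z \in s -> lin z -> a z = b z) ->
    filter (predI a lin) s = filter (predI b lin) s.
  move=> H; apply: eq_in_filter => z zs /=; case: (boolP (lin z)) => zl.
    by rewrite (H z zs zl).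
  by rewrite !andbF.
have ff s : filter (predI pred0 lin) s = [::] by rewrite (eq_filter (a2 := pred0)) ?filter_pred0.
have tt s : filter (predI predT lin) s = filter lin s by exact: eq_filter.
split; rewrite parts.
- rewrite (@keep _ predT p) ?(@keep _ pred0 r) ?(@keep _ pred0 q) ?ff ?tt ?cats0// => z zs zl;
    by rewrite obx//; have := dis z zl; rewrite zs /=; case: (_ \in _); case: (_ \in _).
- rewrite (@keep _ predT q) ?(@keep _ pred0 r) ?(@keep _ pred0 p) ?ff ?tt ?cats0// => z zs zl;
    by rewrite oxb//; have := dis z zl; rewrite zs /=; case: (_ \in _); case: (_ \in _).
rewrite (@keep _ predT r) ?(@keep _ pred0 p) ?(@keep _ pred0 q) ?ff ?tt ?cats0// => z zs zl;
  by rewrite obx// oxb//; have := dis z zl; rewrite zs /=; case: (_ \in _); case: (_ \in _).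
Qed.

Hypothesis derived_vec : forall k l, vec_equiv W k l ->
  forall x ss, size ss = (size k).-1 -> nonerasing ss ->
  derived Sigma (weave x k ss) (weave x l ss).
(** Both parts of each exponent are positive, so the first and the last [x] stay apart with the
    other letters [s] of the block between them. *)
Hypothesis derived_power : forall x c c', 1 < c -> 1 < c' ->
  equiv W (nseq c x) (nseq c' x) -> exists d, [/\ 0 < d, d < c, d < c' &
    forall s, derived Sigma (nseq (c - d) x ++ s ++ nseq d x)
                            (nseq (c' - d) x ++ s ++ nseq d x)].

Lemma filter_mark_notin x s : x \notin s -> filter (mark x) s = filter lin s.
Proof.
move=> xs; apply: eq_in_filter => z zs; rewrite /mark.
by case: eqP => // e; rewrite -e zs in xs.
Qed.

(** If a linear letter separates the first and last [x], then after [gather] an identity in one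
    nonlinear letter is applied; otherwise all [x] lie in one block and only their number has to be
    adjusted. *)
Lemma derived_redistribute u v x :
  equiv W u U -> equiv W v U -> 1 < count_mem x u ->
  exists u', [/\ derived Sigma u u', filter (mark x) u' = filter (mark x) v &
    filter (predC1 x) u' = filter (predC1 x) u].
Proof.
move=> uU vU xu.
have uv : equiv W u v by apply: equiv_trans uU _; exact: equiv_sym.
have xl : ~~ lin x.
  by rewrite /lin -(equiv_linear x uU); case: (count_mem x u) xu => [|[|]].
have xv : 1 < count_mem x v by rewrite -occurs_beforexx -(equiv_occurs_before _ _ uv) occurs_beforexx.
have [p [r [q [eu xp xq]]]] := first_last_split xu.
have [p' [r' [q' [ev xp' xq']]]] := first_last_split xv.
have [linp linq linr] : [/\ filter lin p = filter lin p', filter lin q = filter lin q'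
    & filter lin r = filter lin r'].
  rewrite eu in uU; rewrite ev in vU; rewrite eu ev in uv.
  have [-> -> ->] := lin_parts uU xp xq xl.
  have [-> -> ->] := lin_parts vU xp' xq' xl.
  rewrite (filter_lin_eq uU vU).
  by split; apply: eq_filter => z; rewrite !(equiv_occurs_before _ _ uv).
have fpx s : filter (predC1 x) (filter (mark x) s) = filter lin s.
  rewrite -filter_predI; apply: eq_filter => z /=; rewrite /mark.
  by case: eqP => // ->; rewrite (negbTE xl).
have markx : mark x x by rewrite /mark eqxx.
have [rl|rl] := boolP (has lin r).
- have uU' := uU; rewrite eu in uU'.
  have [k [ss [szk ne fl fs D]]] := gather uU' xl rl.
  set T := filter lin r in fs *.
  have [l szl el] := weave_of_word x (filter (mark x) (x :: r' ++ [:: x])).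
  have fx : filter (predC1 x) (filter (mark x) (x :: r' ++ [:: x])) = T.
    by rewrite fpx /= filter_cat /= (negbTE xl) cats0 -linr.
  rewrite -[filter (fun z => z != x) _]/(filter (predC1 x) _) fx in szl el.
  have szT : size ss = size T by have := congr1 size fs; rewrite !size_map.
  have ssr s z : s \in ss -> z \in s -> z != x /\ z \in r.
    move=> sss zs; have : z \in flatten ss by apply/flattenP; exists s.
    by rewrite fl mem_filter => /andP[].
  have un : uniq (filter lin p ++ T ++ filter lin q).
    by have := uniq_filter_lin uU; rewrite eu filter_cat /= (negbTE xl) filter_cat /= (negbTE xl).
  have uT : uniq T by move: un; rewrite cat_uniq cat_uniq => /and5P[].
  have disj z : z \in T -> z \notin filter lin p /\ z \notin filter lin q.
    move: un; rewrite !cat_uniq => /and3P[_ /hasPn Hp /and3P[_ /hasPn Hq _]] zT.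
    split; first by apply: Hp; rewrite mem_cat zT.
    by apply/negP => /Hq; rewrite /= zT.
  have xT : x \notin T by rewrite mem_filter (negbTE xl).
  (* Restricted to [x] and [T], the gathered word and [v] become weaves with one-letter
     separators. *)
  have KL : vec_equiv W k l.
    apply: (vec_equivI uT xT); rewrite ?szk ?szl ?szT//.
    have E1 : equiv W (p ++ weave x k ss ++ q) v.
      by apply: equiv_trans uv; apply: equiv_sym; rewrite eu; apply: equiv_derived D.
    have := equiv_filter [pred z | (z == x) || (z \in T)] E1.
    set b := [pred z | _].
    have b0 s : x \notin s -> (forall z, z \in T -> z \notin filter lin s) -> filter b s = [::].
      move=> xs Ts; rewrite -(filter_pred0 s); apply: eq_in_filter => z zs /=.
      have [zx|_ /=] := eqVneq z x; first by rewrite -zx zs in xs.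
      apply/negbTE/negP => zT; have /negP := Ts z zT; rewrite mem_filter zs andbT.
      by move: zT; rewrite mem_filter => /andP[->].
    rewrite ev -(cat1s x q') (catA r') -cat_cons !(filter_cat b _ (_ ++ _)).
    rewrite !(filter_cat b _ q) !(filter_cat b _ q').
    have bp : filter b p = [::] by apply: b0 => // z /disj[].
    have bq : filter b q = [::] by apply: b0 => // z /disj[].
    have bp' : filter b p' = [::] by apply: b0 => // z /disj[]; rewrite linp.
    have bq' : filter b q' = [::] by apply: b0 => // z /disj[_]; rewrite linq.
    rewrite bp bq bp' bq' !cats0 !cat0s.
    have -> : filter b (x :: r' ++ [:: x]) = weave x l [seq [:: t] | t <- T].
      rewrite -el; apply: eq_in_filter => z; rewrite /b /mark /= in_cons mem_cat inE.
      case: eqP => //= _; by rewrite orbF => zr; rewrite /T linr mem_filter zr andbT.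
    have fb : map (filter b) ss = [seq [:: t] | t <- T].
      rewrite -fs; apply/eq_in_map => s sss; apply: eq_in_filter => z zs /=.
      have [/negbTE-> zr] := ssr s z sss zs.
      by rewrite mem_filter zr andbT.
    by rewrite filter_weave ?fb// /b /= eqxx.
  exists (p ++ weave x l ss ++ q); split.
  + rewrite eu; apply: (derived_trans D); apply/derived_context/derived_vec => //.
    by rewrite szk.
  + rewrite ev -(cat1s x q') (catA r') -cat_cons !filter_cat el filter_weave//.
    rewrite !(filter_mark_notin xp, filter_mark_notin xq, filter_mark_notin xp', filter_mark_notin xq').
    rewrite linp linq -fs; congr (_ ++ weave _ _ _ ++ _); apply/eq_in_map => s sss.
    by apply: filter_mark_notin; apply/negP => /(ssr s _ sss)[]; rewrite eqxx.
  rewrite eu !filter_cat /= !filter_cat /= eqxx filter_neq_weave ?szl ?szT// fl.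
  by rewrite filter_id.
have rl' : ~~ has lin r' by rewrite has_filter -linr -has_filter.
have nl s : ~~ has lin s -> {in s, forall z, ~~ lin z} by move=> /hasPn.
have cu : count_mem x u = (count_mem x r).+2.
  by rewrite eu count_cat /= count_cat /= eqxx (count_memPn xp) (count_memPn xq); lia.
have cv : count_mem x v = (count_mem x r').+2.
  by rewrite ev count_cat /= count_cat /= eqxx (count_memPn xp') (count_memPn xq'); lia.
have := equiv_filter (pred1 x) uv; rewrite !filter_pred1.
move=> /(derived_power xu xv)[d [d0 du dv D]].
set n := count_mem x v in cv dv D *; clearbody n.
exists (p ++ (nseq (n - d) x ++ filter (predC1 x) r ++ nseq d x) ++ q).
have eU1 : equiv W (rcons p x ++ r ++ x :: q) U by rewrite cat_rcons -eu.
have fmr s : {in s, forall z, ~~ lin z} -> filter (mark x) s = nseq (count_mem x s) x.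
  move=> sl; rewrite -filter_pred1; apply: eq_in_filter => z zs.
  by rewrite /mark (negbTE (sl z zs)) orbF.
have fmx i : filter (mark x) (nseq i x) = nseq i x.
  by apply/all_filterP; rewrite all_nseq markx orbT.
have frx : filter (mark x) (filter (predC1 x) r) = [::].
  rewrite -filter_predI -(filter_pred0 r); apply: eq_in_filter => z zr /=.
  by rewrite /mark (negbTE (nl _ rl _ zr)) orbF andbN.
split.
- apply: (derived_trans _ (derived_context p q (D (filter (predC1 x) r)))).
  rewrite {1}eu -cat_rcons.
  (* Only the inner [x] are placed by [gather_block]; each power also contains one of the two outer
     ones. *)
  have ij : (count_mem x u - d).-1 + d.-1 = count_mem x r by rewrite cu; lia.
  have -> : p ++ (nseq (count_mem x u - d) x ++ filter (predC1 x) r ++ nseq d x) ++ q =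
      rcons p x ++ nseq (count_mem x u - d).-1 x ++ filter (predC1 x) r ++
        nseq d.-1 x ++ x :: q.
    have -> : nseq d x = nseq d.-1 x ++ [:: x] by rewrite -(nseqD _ 1) addn1 prednK.
    have -> : nseq (count_mem x u - d) x = x :: nseq (count_mem x u - d).-1 x.
      by rewrite -[RHS]/(nseq _.+1 x) prednK// subn_gt0.
    by rewrite cat_rcons -!catA.
  apply: gather_block => //; [exact: nl | | exact: mem_head].
  by rewrite mem_rcons mem_head.
- rewrite ev !filter_cat /= !filter_cat /= markx !fmx frx /= (fmr r' (nl _ rl')).
  rewrite !filter_mark_notin// linp linq; congr (_ ++ _).
  rewrite -nseqD subnK ?(ltnW dv)// cv /=; congr (_ :: _).
  by elim: (count_mem x r') => //= i ->.
rewrite eu !filter_cat /= !filter_cat /= eqxx filter_id; congr (_ ++ _).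
have fn i : filter (predC1 x) (nseq i x) = [::] by elim: i => //= i ->; rewrite eqxx.
by rewrite !fn cats0.
Qed.

(** The letters of [U] are treated in turn by [derived_redistribute]. A step for [x] keeps the
    projections already matched, because it affects only [x], which is not linear. Once all
    projections agree, [derived_of_marks] applies. *)
Lemma derived_of_equiv u : equiv W u U -> derived Sigma u U.
Proof.
move=> uU.
have lin_absent x w : equiv W w U -> ~~ (1 < count_mem x w) ->
    filter (mark x) w = filter lin w.
  move=> wU; have := equiv_linear x wU; rewrite -/(lin x).
  case E : (count_mem x w) => [|[|]]//= xl _; last first.
    by apply: eq_filter => z; rewrite /mark; case: eqP => // ->; rewrite -xl.
  by apply: filter_mark_notin; apply/count_memPn.
have agree : forall s : seq A, exists u', derived Sigma u u' /\
    forall x, x \in s -> filter (mark x) u' = filter (mark x) U.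
  elim=> [|x s [u1 [uu1 agree]]]; first by exists u; split=> //; exact: derived_refl.
  have u1U := equivU_derived uU uu1.
  have UU : equiv W U U by exact: equiv_refl.
  (* The projection of a letter occurring at most once has only linear letters, on which equivalent
     words agree. *)
  have [xu1|xu1] := boolP (1 < count_mem x u1); last first.
    exists u1; split=> // y; rewrite in_cons => /orP[/eqP->|/agree//].
    rewrite !lin_absent//; first exact: filter_lin_eq.
    by rewrite -occurs_beforexx -(equiv_occurs_before _ _ u1U) occurs_beforexx.
  have [u2 [u12 fx fC]] := derived_redistribute u1U UU xu1.
  exists u2; split; first exact: derived_trans u12.
  move=> y; rewrite in_cons; case: eqVneq => [->//|yx /= /agree <-].
  have nyx w : filter (mark y) w = filter (mark y) (filter (predC1 x) w).
    rewrite -filter_predI; apply: eq_filter => z /=; rewrite /mark.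
    have [->|_] := eqVneq z x; last by rewrite andbT.
    rewrite andbF eq_sym (negbTE yx) /=; apply/negbTE.
    by rewrite /lin -(equiv_linear x u1U); case: (count_mem x u1) xu1 => [|[|]].
  by rewrite nyx fC -nyx.
have [u' [uu' agreeU]] := agree U; apply: (derived_trans uu').
have u'U := equivU_derived uU uu'.
apply: (derived_of_marks (c := [::]) u'U (equiv_refl W U)) => x /=.
have [/agreeU//|xU] := boolP (x \in U).
rewrite !lin_absent//; try exact: equiv_refl; first exact: filter_lin_eq u'U (equiv_refl W U).
  by rewrite (count_memPn xU).
by rewrite -occurs_beforexx (equiv_occurs_before _ _ u'U) occurs_beforexx (count_memPn xU).
Qed.
End Normalization.

(** * A finite basis under the condition *)

Lemma wsubst_letter (A B : eqType) (x : A) (b : B) (u : seq A) :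
  wsubst (fun z => if z == x then [:: b] else [::]) u = nseq (count_mem x u) b.
Proof. by elim: u => //= z u; rewrite wsubst_cons => ->; case: (z == x). Qed.

Section PowersInW.
Variables (A : choiceType) (W : set (seq A)).

Lemma power_in_leq j k : j <= k -> power_in W k -> power_in W j.
Proof.
move=> jk [a ak]; exists a; apply: (@subword_in_catl _ _ _ (nseq (k - j) a)).
by rewrite -nseqD subnKC.
Qed.

(** Erase all letters but [x], and send [x] to a letter whose power lies in a word of [W]. *)
Lemma equiv_count_power (u v : seq A) x :
  equiv W u v -> power_in W (count_mem x u) -> count_mem x v = count_mem x u.
Proof.
move=> [_ uv] [a]; rewrite -(wsubst_letter x a u) => H.
have := uv _ (or_introl H); rewrite !wsubst_letter => /(congr1 size).
by rewrite !size_nseq => ->.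
Qed.

End PowersInW.

(** As instances never erase letters, each choice of present and absent separators needs its own
    pattern. *)
Definition optional_letters : seq (seq nat * seq nat) :=
  [:: ([::], [::]); ([:: 2], [::]); ([::], [:: 3]); ([:: 2], [:: 3])].

(** The swaps of [equiv_swap], with the recurring letters in one order only; exchanging the two
    letters gives the other order. *)
Definition swap_patterns : seq (seq nat * seq nat) :=
  [seq ((0 :: T.1 ++ 1 :: T.2) ++ [:: 0; 1], (0 :: T.1 ++ 1 :: T.2) ++ [:: 1; 0])
    | T <- optional_letters] ++
  [seq ([:: 0; 1] ++ T.1 ++ 0 :: T.2 ++ [:: 1], [:: 1; 0] ++ T.1 ++ 0 :: T.2 ++ [:: 1])
    | T <- optional_letters].

Definition power_patterns (i d : nat) : seq (seq nat * seq nat) :=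
  [seq (nseq i 0 ++ T ++ nseq d 0, nseq i.+1 0 ++ T ++ nseq d 0)
    | T <- [:: [::]; [:: 1]]].

Section FinitelyBased.
Variables (A : choiceType) (W : set (seq A)) (enc : nat -> A).
Hypothesis enc_inj : injective enc.
Hypothesis hW : forall u : seq A, W u -> adjacent_first_last u.

Lemma swap_patterns_equiv P :
  P \in swap_patterns -> equiv W (map enc P.1) (map enc P.2).
Proof.
rewrite mem_cat => /orP[] /mapP[T _ ->] /=.
  have := @equiv_swap A W hW (enc 0 :: map enc T.1 ++ enc 1 :: map enc T.2) [::]
    (enc 0) (enc 1).
  rewrite !(in_cons, mem_cat) !eqxx !orbT => /(_ isT).
  by rewrite !map_cat /= -!catA.
have := @equiv_swap A W hW [::] (map enc T.1 ++ enc 0 :: map enc T.2 ++ [:: enc 1])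
  (enc 0) (enc 1).
rewrite !(in_cons, mem_cat) !eqxx !orbT => /(_ isT).
by rewrite !map_cat /= map_cat.
Qed.

Lemma swap_patterns_derived (Sigma : seq (identity A)) :
  (forall P, P \in swap_patterns -> derives_pattern Sigma P.1 P.2) ->
  forall p q (x y : A), (x \in p) && (y \in p) || (x \in q) && (y \in q) ->
  derived Sigma (p ++ x :: y :: q) (p ++ y :: x :: q).
Proof.
move=> HS p q x y.
pose T (s t : seq A) := (if s is [::] then [::] else [:: 2], if t is [::] then [::] else [:: 3]).
have TL s t : T s t \in optional_letters by case: s t => [|? ?] [|? ?].
pose theta (x y : A) s t (i : nat) := match i with
  | 0 => [:: x] | 1 => [:: y] | 2 => if s is [::] then [:: x] else s
  | _ => if t is [::] then [:: x] else t end.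
have theta0 a b s t i : theta a b s t i != [::].
  by case: i => [|[|[|i]]] //=; [case: s | case: t].
have T1 a b s t : wsubst (theta a b s t) (T s t).1 = s.
  by case: s => // c s; rewrite wsubst1.
have T2 a b s t : wsubst (theta a b s t) (T s t).2 = t.
  by case: t => // c t; rewrite wsubst1.
have right a b s t r1 r2 : derived Sigma (r1 ++ a :: s ++ b :: t ++ [:: a; b] ++ r2)
                               (r1 ++ a :: s ++ b :: t ++ [:: b; a] ++ r2).
  have := HS ((0 :: (T s t).1 ++ 1 :: (T s t).2) ++ [:: 0; 1],
              (0 :: (T s t).1 ++ 1 :: (T s t).2) ++ [:: 1; 0]).
  rewrite mem_cat (map_f _ (TL s t)) => /(_ isT _ (theta0 a b s t)) /=.
  rewrite -!cat_cons !(wsubst_cat, wsubst_cons, T1, T2) !cat_cons !cat0s -!catA !cat_cons /=.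
  by move/(derived_context r1 r2); rewrite /= -!catA /= -!catA.
have left a b s t r1 r2 : derived Sigma (r1 ++ [:: a; b] ++ s ++ a :: t ++ b :: r2)
                               (r1 ++ [:: b; a] ++ s ++ a :: t ++ b :: r2).
  have := HS ([:: 0; 1] ++ (T s t).1 ++ 0 :: (T s t).2 ++ [:: 1],
              [:: 1; 0] ++ (T s t).1 ++ 0 :: (T s t).2 ++ [:: 1]).
  rewrite mem_cat (map_f (fun T : seq nat * seq nat => ([:: 0; 1] ++ T.1 ++ 0 :: T.2 ++ [:: 1],
    [:: 1; 0] ++ T.1 ++ 0 :: T.2 ++ [:: 1])) (TL s t)) orbT => /(_ isT _ (theta0 a b s t)) /=.
  rewrite !(wsubst_cons, wsubst_cat, T1, T2) /=.
  by move/(derived_context r1 r2); rewrite /= -!catA /= -!catA.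
have two s : x != y -> x \in s -> y \in s ->
    exists s1 s2 s3, s = s1 ++ x :: s2 ++ y :: s3 \/ s = s1 ++ y :: s2 ++ x :: s3.
  move=> xy; case/path.splitPr => s1 s2; rewrite mem_cat in_cons eq_sym (negbTE xy) /=.
  by case/orP=> /path.splitPr[r1 r2];
    [exists r1, r2, s2; right; rewrite -catA | exists s1, r1, r2; left].
have [->|xy] := eqVneq x y; first by move=> _; exact: derived_refl.
case/orP=> /andP[xp yp]; have [s1 [s2 [s3 [->|->]]]] := two _ xy xp yp.
- by have := right x y s2 s3 s1 q; rewrite -!catA /= -!catA.
- by have /derived_sym := right y x s2 s3 s1 q; rewrite -!catA /= -!catA.
- have /(derived_context p [::]) := left x y s1 s2 [::] s3; rewrite /= !cats0.
  by rewrite /= -?catA.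
have /(derived_context p [::])/derived_sym := left y x s1 s2 [::] s3.
by rewrite /= !cats0.
Qed.

Lemma occurs_before_nseq (x : A) i s y z : 0 < i -> x \in s ->
  occurs_before (nseq i x ++ s) y z = (y == x) && (z \in s) || occurs_before s y z.
Proof.
case: i => // i _ xs; elim: i => [|i IH] //=; first by rewrite occurs_before_cons.
rewrite occurs_before_cons IH; case: eqP => //= ->.
case: (boolP (z \in s)) => [zs|zs]; first by rewrite orbT.
rewrite in_cons mem_cat mem_nseq (negbTE zs) orbF.
case: (eqVneq z x) => [e|zx]; first by rewrite -e (negbTE zs) in xs.
by rewrite andbF.
Qed.

(** A substitution into subwords of [W] that keeps [x] sends it to a power of some [a] and produces
    [a^(n+1-d) T a^d], with [T] the image of [s]. The condition excludes this for nonempty [T], the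
    maximality of [n] for empty [T]. *)
Lemma power_equiv n d (s : seq A) (x : A) i i' :
  (forall k, power_in W k -> k <= n) -> 0 < d < n.+1 ->
  (forall (b : A) (T : seq A), T != [::] ->
    ~ subword_in W (nseq (n.+1 - d) b ++ T ++ nseq d b)) ->
  n.+1 - d <= i -> n.+1 - d <= i' ->
  equiv W (nseq i x ++ s ++ nseq d x) (nseq i' x ++ s ++ nseq d x).
Proof.
move=> maxn /andP[d0 dn] nsub ni ni'.
have i0 : 0 < i by apply: leq_trans ni; rewrite subn_gt0.
have i'0 : 0 < i' by apply: leq_trans ni'; rewrite subn_gt0.
have xs : x \in s ++ nseq d x by rewrite mem_cat mem_nseq d0 eqxx orbT.
split.
  split=> [z|y z]; last by rewrite !occurs_before_nseq.
  by rewrite !(mem_cat _ (nseq _ x)) !mem_nseq i0 i'0.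
have no j phi : n.+1 - d <= j -> phi x != [::] ->
    ~ subword_in W (wsubst phi (nseq j x ++ s ++ nseq d x)).
  move=> nj phix H.
  have j0 : 0 < j by apply: leq_trans nj; rewrite subn_gt0.
  have [] := wsubst_nonlinear_power hW (x := x) _ phix H.
    by rewrite !count_cat !count_nseq /= eqxx; lia.
  move=> a xa; have r0 : 0 < size (phi x) by rewrite lt0n size_eq0.
  move: H; rewrite !wsubst_cat !wsubst_nseq xa !flatten_nseq_nseq.
  set r := size (phi x) in r0 *.
  have jr : j <= j * r by rewrite leq_pmulr.
  have dr : d <= d * r by rewrite leq_pmulr.
  have -> : j * r = (j * r - (n.+1 - d)) + (n.+1 - d) by rewrite subnK// (leq_trans nj).
  have -> : d * r = d + (d * r - d) by rewrite subnKC.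
  set k := (j * r - _); set l := (d * r - d); move=> H.
  have {}H : subword_in W (nseq (n.+1 - d) a ++ (wsubst phi s) ++ nseq d a).
    apply: (@subword_in_catr _ _ (nseq k a)); apply: (@subword_in_catl _ _ _ (nseq l a)).
    by move: H; rewrite !nseqD -!catA.
  have [e|ne] := eqVneq (wsubst phi s) [::]; last exact: nsub ne H.
  move: H; rewrite e /= -nseqD subnK; last exact: ltnW.
  by move=> H; have := maxn n.+1 (ex_intro _ a H); rewrite ltnn.
move=> phi; have [x0|x0] := eqVneq (phi x) [::].
  have e j : flatten (nseq j (phi x)) = [::] by rewrite x0; elim: j.
  by rewrite !wsubst_cat !wsubst_nseq !e.
by case=> /no; [move/(_ ni x0) | move/(_ ni' x0)].
Qed.

(** The basis joins three finite lists: the swaps, the identities of [vec_basis], and those changing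
    the power of a letter within a block. *)
Theorem finitely_based_of_condition (m : option nat) :
  is_max_power W m ->
  (m = None \/ exists n, m = Some n /\ exists d, 0 < d < n + 1 /\
    forall (b : A) (T : seq A), T != [::] ->
      ~ subword_in W (nseq (n + 1 - d) b ++ T ++ nseq d b)) ->
  finitely_based A (adjoin_one A0 * SW W)%type.
Proof.
move=> hm cond.
have [Lp [Lp_equiv Lp_derived]] : exists Lp : seq (seq nat * seq nat),
    (forall P, P \in Lp -> equiv W (map enc P.1) (map enc P.2)) /\
    forall Sigma, (forall P, P \in Lp -> derives_pattern (A := A) Sigma P.1 P.2) ->
    forall (x : A) c c', 1 < c -> 1 < c' -> equiv W (nseq c x) (nseq c' x) ->
    exists d, [/\ 0 < d, d < c, d < c' &
      forall s, derived Sigma (nseq (c - d) x ++ s ++ nseq d x)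
                              (nseq (c' - d) x ++ s ++ nseq d x)].
  have eqc (x : A) c c' : equiv W (nseq c x) (nseq c' x) -> power_in W c -> c' = c.
    by move=> /(equiv_count_power (x := x)); rewrite !count_nseq /= eqxx !mul1n.
  have same Sigma (x : A) c c' : 1 < c -> c = c' -> exists d, [/\ 0 < d, d < c, d < c' &
      forall s, derived (A := A) Sigma (nseq (c - d) x ++ s ++ nseq d x)
                              (nseq (c' - d) x ++ s ++ nseq d x)].
    by move=> c1 <-; exists 1; split=> // s; exact: derived_refl.
  case: cond => [m0|[n [mn [d [dn nsub]]]]].
    (* With unbounded powers, equivalent powers of [x] have equal exponents. *)
    exists [::]; split=> // Sigma _ x c c' c1 c'1 cc'; apply: same => //.
    rewrite m0 in hm; have [k ck hk] := hm c.
    by rewrite (eqc _ _ _ cc' (power_in_leq ck hk)).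
  rewrite mn in hm; case: hm => n0 [hn maxn]; rewrite addn1 in dn nsub.
  have [d0 dn'] := andP dn.
  exists (power_patterns (n.+1 - d) d); split.
    move=> _ /mapP[T _ ->]; rewrite !map_cat !map_nseq.
    by apply: power_equiv maxn dn nsub _ _.
  move=> Sigma HS x c c' c1 c'1 cc'.
  have [e|ne] := eqVneq c c'; first exact: same.
  have big k k' : equiv W (nseq k x) (nseq k' x) -> k != k' -> n < k.
    move=> E kk'; rewrite ltnNge; apply: contraNN kk' => kn.
    by rewrite (eqc _ _ _ E (power_in_leq kn hn)).
  have cn := big _ _ cc' ne.
  have c'n : n < c' by apply: big (equiv_sym cc') _; rewrite eq_sym.
  exists d; split=> //; [by lia | by lia |].
  (* Unequal equivalent exponents both exceed [n], so both sides can be reduced to the exponent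
     [n.+1 - d] before [s]. *)
  have red i s : derived Sigma (nseq (i + (n.+1 - d)) x ++ s ++ nseq d x)
                               (nseq (n.+1 - d) x ++ s ++ nseq d x).
    elim: i => [|i IH]; first exact: derived_refl.
    apply: derived_trans IH; rewrite addSnnS nseqD [X in derived _ _ (X ++ _)]nseqD -!catA.
    rewrite -[nseq i x ++ _]cats0 -[X in derived _ _ X]cats0 -!catA.
    apply: derived_sym; have H T theta : T \in [:: [::]; [:: 1]] ->
        (forall i, theta i != [::]) -> theta 0 = [:: x] ->
        derived Sigma (nseq (n.+1 - d) x ++ wsubst theta T ++ nseq d x)
                      (nseq (n.+1 - d).+1 x ++ wsubst theta T ++ nseq d x).
      move=> TL th0 thx.
      have := HS _ (map_f (fun T => (nseq (n.+1 - d) 0 ++ T ++ nseq d 0,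
         nseq (n.+1 - d).+1 0 ++ T ++ nseq d 0)) TL) theta th0.
      by rewrite /fst /snd !wsubst_cat !wsubst_nseq thx !(flatten_nseq_nseq x _ 1) !muln1.
    have [->|s0] := eqVneq s [::].
      by rewrite !cats0; apply/derived_cat/(H [::] (fun=> [:: x])) => //; exact: derived_refl.
    have := H [:: 1] (fun i => if i is 0 then [:: x] else s).
    rewrite wsubst1 !cats0 => K; apply/derived_cat/K => //; first exact: derived_refl.
    by case.
  move=> s.
  have Ec k : n < k -> k - d = (k - n.+1) + (n.+1 - d) by lia.
  rewrite (Ec _ cn) (Ec _ c'n); apply: derived_trans (red _ _) _.
  exact/derived_sym/red.
have [Lv [Lv_equiv Lv_derived]] := vec_basis W enc.
have [Ls [Ls_equiv Ls_derived]] : exists Ls : seq (seq nat * seq nat),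
    (forall P, P \in Ls -> equiv W (map enc P.1) (map enc P.2)) /\
    forall Sigma, (forall P, P \in Ls -> derives_pattern (A := A) Sigma P.1 P.2) ->
    forall p q (x y : A), (x \in p) && (y \in p) || (x \in q) && (y \in q) ->
    derived Sigma (p ++ x :: y :: q) (p ++ y :: x :: q).
  by exists swap_patterns; split; [exact: swap_patterns_equiv | exact: swap_patterns_derived].
have LW P : P \in Ls ++ Lv ++ Lp -> equiv W (map enc P.1) (map enc P.2).
  by rewrite !mem_cat => /or3P[/Ls_equiv|/Lv_equiv|/Lp_equiv].
have [Sigma [SW SL]] := patterns_basis enc_inj LW.
exists Sigma; split=> [[u v] /SW uv|[u v] /equivP uv]; first exact/equivP.
have : derived Sigma (word_of u) (word_of v).
  apply: (@derived_of_equiv A W Sigma SW _ (word_of v)) uv.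
  - by apply: Ls_derived => P PL; apply: SL; rewrite mem_cat PL.
  - by apply: Lv_derived => P PL; apply: SL; rewrite !mem_cat PL orbT.
  by apply: Lp_derived => P PL; apply: SL; rewrite !mem_cat PL !orbT.
by case=> [/word_of_inj->|[p [q [/word_of_inj-> /word_of_inj->]]]] //; exact: derivable_refl.
Qed.

End FinitelyBased.

(** * The identities without a finite basis *)

Section CountSubst.
Variables (A : eqType) (phi : A -> seq A) (b : A).
Implicit Types (u p q : seq A).

Lemma count_wsubst u :
  count [pred x | b \in phi x] u <= count_mem b (wsubst phi u).
Proof.
elim: u => //= x u IH; rewrite wsubst_cons count_cat; apply: leq_add => //.
by rewrite -has_pred1 has_count lt0n; case: (count_mem b _).
Qed.

Lemma count_mem_wsubst x u :
  b \in phi x -> count_mem x u <= count_mem b (wsubst phi u).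
Proof.
move=> bx; apply: leq_trans (count_wsubst u); apply: sub_count => y /eqP->.
exact: bx.
Qed.

(** Once the letters whose images avoid [b] are discarded, the two words are permutations of each
    other. *)
Lemma eq_count_wsubst p q :
  (forall x, b \in phi x -> count_mem x p = count_mem x q) ->
  count_mem b (wsubst phi p) = count_mem b (wsubst phi q).
Proof.
move=> pq; pose a := [pred x | b \in phi x].
have E u : count_mem b (wsubst phi u) = count_mem b (wsubst phi (filter a u)).
  elim: u => //= x u IH; rewrite wsubst_cons count_cat IH.
  case: ifP => [_|/negbT/count_memPn->//]; by rewrite wsubst_cons count_cat.
have F x u : count_mem x (filter a u) = if a x then count_mem x u else 0.
  rewrite count_filter; case: ifP => ax.
    by apply: eq_count => y /=; case: eqP => // ->.
  rewrite -(count_pred0 u); apply: eq_count => y /=.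
  by case: eqP => // ->.
rewrite E [RHS]E; apply/permP/perm_flatten/perm_map/allP => x _ /=.
by rewrite !F; case: ifP => // ax; rewrite (pq x ax).
Qed.

(** Each [x] contributes at least one [b], so a second source would exceed the bound. *)
Lemma wsubst_single_source x y u :
  b \in phi x -> count_mem b (wsubst phi u) <= count_mem x u ->
  y \in u -> b \in phi y -> y = x.
Proof.
move=> bx le yu byy; apply/eqP; apply: contraLR le => yx; rewrite -ltnNge.
apply: leq_trans (count_wsubst u).
have -> : count [pred z | b \in phi z] u =
    count_mem x u + count (predI [pred z | b \in phi z] (predC1 x)) u.
  elim: u {yu} => //= z u ->; rewrite addnACA; congr (_ + _).
  by case: eqP => [->|_] /=; rewrite ?bx ?andbT.
by rewrite -addn1 leq_add2l -has_count; apply/hasP; exists y => //=; rewrite byy.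
Qed.

End CountSubst.

Section Chain.
Variables (A : choiceType) (enc : nat -> A).
Hypothesis enc_inj : injective enc.

Definition chain_x : A := enc 0.
Definition chain_y (i : nat) : A := enc i.*2.+1.
Definition chain_z (i : nat) : A := enc i.*2.+2.
Notation x := chain_x.
Notation y := chain_y.
Notation z := chain_z.

Definition chain_mid (m k : nat) : seq A :=
  flatten [seq [:: y i; z i] | i <- iota m k].

(* In chain_word k N the last y_i and the first z_i alternate, y_0 z_0 y_1 z_1 ...,
   between the first and the last x, all in one block without linear letters. *)
Definition chain_word (k N : nat) : seq A :=
  x :: map y (iota 0 N) ++ chain_mid 0 N ++ map z (iota 0 N) ++ nseq k x.

Lemma chain_xy i : (x == y i) = false.
Proof. by rewrite (inj_eq enc_inj). Qed.
Lemma chain_xz i : (x == z i) = false.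
Proof. by rewrite (inj_eq enc_inj). Qed.
Lemma chain_yz i j : (y i == z j) = false.
Proof. by rewrite (inj_eq enc_inj) -!muln2; lia. Qed.
Lemma chain_yy i j : (y i == y j) = (i == j).
Proof. by rewrite (inj_eq enc_inj) -!muln2; lia. Qed.
Lemma chain_zz i j : (z i == z j) = (i == j).
Proof. by rewrite (inj_eq enc_inj) -!muln2; lia. Qed.

Lemma mem_chain_mid_y m k i : (y i \in chain_mid m k) = (m <= i < m + k).
Proof.
elim: k m => [|k IH] m; first by rewrite in_nil; lia.
by rewrite /chain_mid /= !in_cons -/(chain_mid _ _) IH chain_yz chain_yy; lia.
Qed.

Lemma mem_chain_mid_z m k i : (z i \in chain_mid m k) = (m <= i < m + k).
Proof.
elim: k m => [|k IH] m; first by rewrite in_nil; lia.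
rewrite /chain_mid /= !in_cons -/(chain_mid _ _) IH eq_sym chain_yz chain_zz; lia.
Qed.

Lemma chain_mid_zy m k i j :
  occurs_before (chain_mid m k) (z i) (y j) = [&& m <= i, i < j & j < m + k].
Proof.
elim: k m => [|k IH] m; first by rewrite -[occurs_before _ _ _]/false; lia.
rewrite /chain_mid /= !occurs_before_cons -/(chain_mid _ _) IH mem_chain_mid_y.
by rewrite (eq_sym (z i)) chain_yz chain_zz /=; lia.
Qed.

Section ChainWord.
Variables (k N : nat).
Notation w := (chain_word k N).

Lemma mem_chain_y i : (y i \in map y (iota 0 N)) = (i < N).
Proof. by rewrite mem_map ?mem_iota// => a b /eqP; rewrite chain_yy => /eqP. Qed.
Lemma mem_chain_z i : (z i \in map z (iota 0 N)) = (i < N).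
Proof. by rewrite mem_map ?mem_iota// => a b /eqP; rewrite chain_zz => /eqP. Qed.

Lemma chain_occurs_xy i : i < N -> occurs_before w x (y i).
Proof.
by move=> iN; rewrite occurs_before_cons eqxx !mem_cat mem_chain_y iN.
Qed.

Lemma chain_occurs_zx i : 0 < k -> i < N -> occurs_before w (z i) x.
Proof.
move=> k0 iN; rewrite /chain_word 2!catA -cat_cons occurs_before_cat.
by rewrite in_cons !mem_cat mem_chain_z iN mem_nseq k0 eqxx !orbT.
Qed.

Lemma chain_occurs_zy i : i.+1 < N -> occurs_before w (z i) (y i.+1).
Proof.
move=> iN; rewrite occurs_before_cons !occurs_before_cat chain_mid_zy.
by rewrite ltnSn iN !orbT.
Qed.

(** The first [z i] comes after the last [y i]. *)
Lemma chain_not_occurs_zy i : ~~ occurs_before w (z i) (y i).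
Proof.
have nob s a b : a \notin s \/ b \notin s -> occurs_before s a b = false.
  move=> H; apply/negP => /occurs_before_mem[sa sb].
  by case: H; rewrite ?sa ?sb.
have zY : z i \notin map y (iota 0 N).
  by apply/mapP => -[j _ /eqP]; rewrite eq_sym chain_yz.
have yZ : y i \notin map z (iota 0 N).
  by apply/mapP => -[j _ /eqP]; rewrite chain_yz.
have yX : y i \notin nseq k x by rewrite mem_nseq eq_sym chain_xy andbF.
rewrite occurs_before_cons !occurs_before_cat chain_mid_zy (eq_sym (z i)) chain_xz /=.
rewrite ltnn /= (negbTE zY) !mem_cat (negbTE yZ) (negbTE yX) /= andbF.
by rewrite !nob /= ?andbF //; [right | right | left].
Qed.

Lemma chain_nonlinear a : 0 < k -> a \in w -> 1 < count_mem a w.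
Proof.
move=> k0 aw.
have two s t : a \in s -> a \in t -> 1 < count_mem a (s ++ t).
  by rewrite -!has_pred1 !has_count count_cat; apply: leq_add.
have twice : (a \in [:: x] /\ a \in nseq k x) \/
    (a \in map y (iota 0 N) /\ a \in chain_mid 0 N) \/
    (a \in chain_mid 0 N /\ a \in map z (iota 0 N)).
  have : [\/ a = x, exists2 i, i < N & a = y i | exists2 i, i < N & a = z i].
    move: aw; rewrite in_cons !mem_cat => /orP[/eqP->|]; first by constructor 1.
    case/or4P=> [/mapP[i]|/flattenP[_ /mapP[i + ->]]|/mapP[i]|].
    - by rewrite mem_iota => iN ->; constructor 2; exists i.
    - by rewrite mem_iota !inE => iN /orP[]/eqP->; [constructor 2|constructor 3]; exists i.
    - by rewrite mem_iota => iN ->; constructor 3; exists i.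
    by rewrite mem_nseq => /andP[_ /eqP->]; constructor 1.
  case=> [->|[i iN ->]|[i iN ->]].
  - by left; rewrite inE mem_nseq k0 eqxx.
  - by right; left; rewrite mem_chain_y mem_chain_mid_y iN.
  by right; right; rewrite mem_chain_z mem_chain_mid_z iN.
rewrite /chain_word -cat1s; case: twice => [[ax ak]|[[ay am]|[am az]]].
- by apply: two => //; rewrite !mem_cat ak !orbT.
- by rewrite count_cat; apply: leq_trans (leq_addl _ _); apply: two; rewrite // mem_cat am.
rewrite !count_cat; apply: leq_trans (leq_addl _ _); apply: leq_trans (leq_addl _ _).
by rewrite addnA; apply: leq_trans (leq_addr _ _); rewrite -count_cat; apply: two.
Qed.

Lemma count_chain_x : count_mem x w = k.+1.
Proof.
rewrite /= eqxx !count_cat count_nseq /= eqxx mul1n.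
have c0 s : x \notin s -> count_mem x s = 0 by move/count_memPn.
rewrite !c0//.
- by apply/mapP => -[j _ /eqP]; rewrite chain_xz.
- by apply/flattenP => -[_ /mapP[j _ ->]]; rewrite !inE chain_xy chain_xz.
- by apply/mapP => -[j _ /eqP]; rewrite chain_xy.
Qed.

End ChainWord.

Variables (W : set (seq A)) (n : nat).
Hypothesis hW : forall u : seq A, W u -> adjacent_first_last u.
Hypothesis n0 : 0 < n.
Hypothesis power_n : power_in W n.
Hypothesis max_n : forall k, power_in W k -> k <= n.

(* phi a is a power of a letter c. The first letter b != c of the image is a first
   occurrence preceded by c, and both b and c occur again later, which adjacency in
   W excludes. *)
Lemma nonlinear_block_not_subword (phi : A -> seq A) (a : A) (s : seq A) :
  (forall b, b \in a :: s ++ [:: a] -> 1 < count_mem b (a :: s ++ [:: a])) ->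
  n < count_mem a (a :: s ++ [:: a]) -> phi a != [::] ->
  ~ subword_in W (wsubst phi (a :: s ++ [:: a])).
Proof.
move=> nonlin cnt phia H.
have [|c ac] := wsubst_nonlinear_power hW (x := a) _ phia H.
  by apply: nonlin; rewrite mem_head.
set u := a :: s ++ _ in nonlin cnt H.
have r0 : 0 < size (phi a) by rewrite lt0n size_eq0.
have ca : c \in phi a by rewrite ac mem_nseq r0 eqxx.
have E : wsubst phi u = nseq (size (phi a)) c ++ wsubst phi s ++ nseq (size (phi a)) c.
  by rewrite wsubst_cons wsubst_cat wsubst1 -ac.
have [e|[i [b [s' [e bc]]]]] := constant_prefix c (wsubst phi s).
  have := count_mem_wsubst u ca; rewrite leqNgt => /negP; apply.
  apply: leq_ltn_trans cnt; apply: max_n; exists c.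
  move: H; rewrite E e -!nseqD count_nseq /= eqxx mul1n; exact.
have : b \in wsubst phi s by rewrite e mem_cat mem_head orbT.
case/mem_wsubst => t ts bt.
have tu : t \in u by rewrite in_cons mem_cat ts orbT.
have bb := leq_trans (nonlin t tu) (count_mem_wsubst u bt).
have {}E : wsubst phi u = nseq (size (phi a) + i).-1 c ++ c :: b :: (s' ++ nseq (size (phi a)) c).
  have K k r : nseq k c ++ c :: r = nseq k.+1 c ++ r by elim: k => //= k ->.
  by rewrite E e K prednK ?addn_gt0 ?r0// nseqD -!catA.
have bin : b \in s' ++ nseq (size (phi a)) c.
  move: bb; rewrite E -cat_rcons count_mem_gt1 mem_cat mem_rcons in_cons (negbTE bc) /=.
  by rewrite mem_nseq (negbTE bc) andbF.
have cin : c \in s' ++ nseq (size (phi a)) c by rewrite mem_cat mem_nseq r0 eqxx orbT.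
rewrite E in H; have cb : c != b by rewrite eq_sym.
case: (adjacent_occurrences hW H cb); rewrite ?(mem_cat _ (nseq _.-1 c)) ?bin ?cin ?orbT//.
  by case.
by case.
Qed.

(** All letters are nonlinear and [x] occurs more than [n] times, so substitutions keeping [x] never
    reach a subword of [W], and the others identify the two words. A further final [x] adds no pair,
    as the word already begins and ends with [x]. *)
Lemma chain_word_equiv N : equiv W (chain_word n N) (chain_word n.+1 N).
Proof.
set s := map y (iota 0 N) ++ chain_mid 0 N ++ map z (iota 0 N).
have E k : chain_word k N = x :: s ++ nseq k x by rewrite /chain_word /s -!catA.
have ES k : nseq k.+1 x = nseq k x ++ [:: x] by rewrite -(nseqD k 1) addn1.
have E2 k : chain_word k.+1 N = x :: (s ++ nseq k x) ++ [:: x] by rewrite E ES catA.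
have no k phi : n <= k -> 0 < k -> phi x != [::] -> ~ subword_in W (wsubst phi (chain_word k N)).
  move=> nk k0; have := @chain_nonlinear k N; have := @count_chain_x k N.
  case: k nk k0 => // k nk _; rewrite E2 => cnt nl; apply: nonlinear_block_not_subword.
    by move=> b; exact: nl.
  by rewrite cnt.
split; last first.
  move=> phi; have [x0|x0] := eqVneq (phi x) [::]; last first.
    by case=> /no; [move/(_ (leqnn _) n0 x0) | move/(_ (leqnSn _) isT x0)].
  have f0 k : flatten (nseq k (phi x)) = [::] by rewrite x0; elim: k.
  by rewrite !E !wsubst_cons !wsubst_cat !wsubst_nseq !f0.
have -> : chain_word n.+1 N = chain_word n N ++ [:: x] by rewrite E2 E /= -catA.
split=> [a|a b]; first by rewrite mem_cat mem_seq1; apply/esym/orb_idr => /eqP->; exact: mem_head.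
rewrite occurs_before_cat [occurs_before [:: x] a b]occurs_before_cons in_nil andbF /=.
apply/esym/orb_idr; rewrite mem_seq1 => /andP[aw /eqP->{b}].
move: aw; rewrite E -(prednK n0) ES catA -cat_cons.
set t := x :: _; rewrite mem_cat occurs_before_cat !mem_seq1 => /orP[at_|/eqP->].
  by rewrite at_ eqxx !orbT.
by rewrite mem_head eqxx !orbT.
Qed.

Hypothesis split_power : forall d, 0 < d < n.+1 -> exists b T,
  T != [::] /\ subword_in W (nseq (n.+1 - d) b ++ T ++ nseq d b).

(** Suppose [xi], with [x] in its image, occurs differently often in [p] and [q]. Then it occurs
    [n.+1] times in [p] and covers all the [x]. The letters covering the first [z i] stand at
    strictly increasing positions of [p], which is too short for this. *)
Lemma chain_step N (phi : A -> seq A) (c c' p q : seq A) :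
  size p < N -> equiv W p q ->
  equiv W (c ++ wsubst phi p ++ c') (chain_word n N) ->
  count_mem x (c ++ wsubst phi p ++ c') = n.+1 ->
  count_mem x (wsubst phi p) = count_mem x (wsubst phi q).
Proof.
move=> pN pq wU cnt; apply: eq_count_wsubst => xi xxi; apply: contrapT => ne.
(* At most [n] occurrences would already fix the number of [xi] in [q]. *)
have cxi : n < count_mem xi p.
  rewrite ltnNge; apply/negP => le; apply: ne; apply/esym.
  exact: equiv_count_power pq (power_in_leq le power_n).
have cle := count_mem_wsubst p xxi.
have [xc xc' cw] : [/\ x \notin c, x \notin c' & count_mem x (wsubst phi p) <= count_mem xi p].
  rewrite !count_cat in cnt.
  split; try (apply/count_memPn); move: cnt cxi cle;
    move: (count_mem x c) (count_mem x c') (count_mem x (wsubst phi p)) (count_mem xi p) => *; lia.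
have cxiE : count_mem xi p = n.+1.
  rewrite !count_cat in cnt; move: cnt cxi cle;
    move: (count_mem x c) (count_mem x c') (count_mem x (wsubst phi p)) (count_mem xi p) => *; lia.
have single e : e \in p -> x \in phi e -> e = xi by exact: wsubst_single_source.
set w := c ++ _ in wU cnt.
have ob a b : occurs_before w a b = occurs_before (chain_word n N) a b.
  exact: (equiv_occurs_before a b wU).
have ob_right (s t : seq A) (a b : A) : a \notin s -> occurs_before (s ++ t) a b -> b \in t.
  move=> sa; rewrite occurs_before_cat (negbTE sa) orbF.
  by case/orP=> /occurs_before_mem[]; rewrite ?(negbTE sa).
have ob_left (s t : seq A) (a b : A) : b \notin t -> occurs_before (s ++ t) a b -> a \in s.
  move=> tb; rewrite occurs_before_cat (negbTE tb) andbF orbF.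
  by case/orP=> /occurs_before_mem[] //; rewrite (negbTE tb).
(* The position in [p] of the letter covering the first [z i] of the word: by [zc] that occurrence
   is not in [c]. *)
pose h i := find (fun e => z i \in phi e) p.
have zc i : i < N -> z i \notin c.
  move=> iN; apply/negP => zc; have := chain_not_occurs_zy n N i; rewrite -ob.
  have := chain_occurs_xy n iN; rewrite -ob => /(ob_right _ _ _ _ xc) yr.
  by rewrite /w occurs_before_cat zc yr !orbT.
have hz i : i < N -> has (fun e => z i \in phi e) p.
  move=> iN; apply: contraT => /hasPn nz.
  have zp : z i \notin wsubst phi p by apply/mem_wsubst => -[e /nz/negP].
  have := chain_occurs_zx n0 iN; rewrite -ob /w catA => /ob_right.
  by rewrite mem_cat (negbTE (zc i iN)) (negbTE zp) (negbTE xc') => /(_ isT).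
have hmono i : i.+1 < N -> h i < h i.+1.
  move=> iN; rewrite ltnNge; apply/negP => hle.
  have iN' := ltnW iN.
  have hp : h i.+1 < size p by rewrite -has_find hz.
  set j := h i.+1 in hle hp.
  have ep : p = take j p ++ nth xi p j :: drop j.+1 p by rewrite -drop_nth// cat_take_drop.
  set p1 := take j p in ep; set e := nth xi p j in ep; set p2 := drop j.+1 p in ep.
  have notin k : j <= h k -> z k \notin wsubst phi p1.
    move=> jk; apply/mem_wsubst => -[f fp1 zf].
    have fi : index f p1 < j by move: fp1; rewrite -index_mem size_takel// ltnW.
    have := before_find xi (leq_trans fi jk); rewrite -(nth_take xi fi) nth_index//.
    by rewrite zf.
  have ze : z i.+1 \in phi e by exact: (nth_find xi (hz _ iN)).
  have ew : w = (c ++ wsubst phi p1) ++ phi e ++ (wsubst phi p2 ++ c').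
    by rewrite /w {1}ep wsubst_cat wsubst_cons -!catA.
  have z1 : z i.+1 \notin c ++ wsubst phi p1 by rewrite mem_cat negb_or zc//= notin.
  have z0 : z i \notin c ++ wsubst phi p1 by rewrite mem_cat negb_or zc//= notin.
  have yr : y i.+1 \notin wsubst phi p2 ++ c'.
    apply/negP => yr; have := chain_not_occurs_zy n N i.+1; rewrite -ob ew.
    by rewrite catA occurs_before_cat mem_cat ze yr !orbT.
  (* Some [y i.+1] follows a [z i], which is not covered before [e], and no [y i.+1] follows a
     [z i.+1]; hence [e] covers a [y i.+1] as well. *)
  have ye : y i.+1 \in phi e.
    have := chain_occurs_zy n iN; rewrite -ob ew => /(ob_right _ _ _ _ z0).
    by rewrite mem_cat (negbTE yr) orbF.
  (* A second [e] would put [y i.+1] after, or [z i.+1] before, the displayed one; hence [e] is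
     linear in [p]. *)
  have e2 : e \notin p2.
    apply: contra yr => ep2; rewrite mem_cat; apply/orP; left.
    by apply/mem_wsubst; exists e.
  have e1 : e \notin p1.
    apply: contra z1 => ep1; rewrite mem_cat; apply/orP; right.
    by apply/mem_wsubst; exists e.
  have exi : e != xi.
    apply: contraTneq cxi => exi; rewrite -exi ep count_cat /= eqxx.
    by rewrite (count_memPn e1) (count_memPn e2) -leqNgt.
  have ein : e \in p by rewrite ep mem_cat mem_head orbT.
  have xe : x \notin phi e by apply: contra exi => /(single e ein)/eqP.
  have sub1 f : f \in p1 -> f \in p by rewrite ep mem_cat => ->.
  have sub2 f : f \in p2 -> f \in p by rewrite ep mem_cat in_cons => ->; rewrite !orbT.
  have x1 : xi \in p1.
    have := chain_occurs_xy n iN; rewrite -ob ew catA => /(ob_left _ _ _ _ yr).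
    rewrite !mem_cat (negbTE xc) (negbTE xe) orbF => /mem_wsubst[f fp1 xf].
    by rewrite -(single f (sub1 f fp1) xf).
  have x2 : xi \in p2.
    have := chain_occurs_zx n0 iN; rewrite -ob ew => /(ob_right _ _ _ _ z1).
    rewrite !mem_cat (negbTE xc') (negbTE xe) orbF => /mem_wsubst[f fp2 xf].
    by rewrite -(single f (sub2 f fp2) xf).
  have cp : count_mem xi p1 + count_mem xi p2 = n.+1.
    by rewrite -cxiE ep count_cat /= (negbTE exi).
  have c1 : 0 < count_mem xi p1 by rewrite -has_count has_pred1.
  have c2 : 0 < count_mem xi p2 by rewrite -has_count has_pred1.
  have [b [T [T0 HT]]] : exists b T, T != [::] /\
      subword_in W (nseq (count_mem xi p1) b ++ T ++ nseq (count_mem xi p2) b).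
    have := split_power (d := count_mem xi p2); rewrite -cp addnK; apply.
    by rewrite c2 -[X in X < _]add0n ltn_add2r.
  (* By [split_power] the image of [p] is a subword of a word in [W], so [q] has the same image. As
     [e] is linear in [q] too, comparing lengths gives equal numbers of [xi]. *)
  pose psi f := if f == xi then [:: b] else if f == e then T else [::].
  have psiE s : e \notin s -> wsubst psi s = nseq (count_mem xi s) b.
    move=> es; rewrite -(wsubst_letter xi b); apply: eq_in_wsubst => f fs.
    by rewrite /psi; case: (f == xi) => //; case: eqP => // fe; rewrite -fe fs in es.
  have psip : wsubst psi p = nseq (count_mem xi p1) b ++ T ++ nseq (count_mem xi p2) b.
    by rewrite ep wsubst_cat wsubst_cons !psiE// /psi (negbTE exi) eqxx.
  have := pq.2 psi; rewrite psip => /(_ (or_introl HT)) psiq.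
  have lin_e : count_mem e q = 1.
    apply/eqP; rewrite -(equiv_linear e pq) ep count_cat /= eqxx.
    by rewrite (count_memPn e1) (count_memPn e2).
  have szq : size (wsubst psi q) = count_mem xi q + count_mem e q * size T.
    elim: (q) => //= f r IH; rewrite wsubst_cons size_cat IH /psi.
    have [->|fx] := eqVneq f xi; first by rewrite (eq_sym xi) (negbTE exi) add0n addnA.
    by case: (eqVneq f e) => _; rewrite !add0n // mulnDl mul1n addnCA.
  apply: ne; rewrite cxiE -cp; have := congr1 size psiq.
  by rewrite szq lin_e !size_cat !size_nseq mul1n addnCA addnC => /addIn.
have hge i : i < N -> i <= h i.
  by elim: i => // i IH iN; apply: leq_ltn_trans (IH (ltnW iN)) (hmono _ iN).
(* The last index gives [N - 1 <= h (N - 1) < size p], against [size p < N]. *)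
case: N pN hge hz {wU cnt ob zc hmono} => // N pN hge hz.
have := hge N (ltnSn N); have := hz N (ltnSn N); rewrite has_find -/(h N) => H1 H2.
by have := leq_ltn_trans H2 H1; rewrite ltnNge -ltnS pN.
Qed.

(** A chain longer than all identities of a supposed basis is taken; derivations then preserve the
    number of [x] in the words equivalent to it, while [chain_word_equiv] changes that number. *)
Theorem not_finitely_based : ~ finitely_based A (adjoin_one A0 * SW W)%type.
Proof.
move=> [Sigma [SW_ SD]].
have [N HN] : exists N, forall e, e \in Sigma ->
    size (word_of e.1) < N /\ size (word_of e.2) < N.
  elim: Sigma {SW_ SD} => [|e Sigma [N IH]]; first by exists 0.
  exists (size (word_of e.1) + size (word_of e.2) + N).+1 => f.
  by rewrite in_cons => /orP[/eqP->|/IH[]]; lia.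
pose good w := equiv W w (chain_word n N) /\ count_mem x w = n.+1.
have step (p q : free_semigroup A) c phi c' : equiv W (word_of p) (word_of q) ->
    size (word_of p) < N -> good (c ++ wsubst phi (word_of p) ++ c') ->
    good (c ++ wsubst phi (word_of q) ++ c').
  move=> pq pN [wU cnt]; split.
    apply: equiv_trans wU; apply/equiv_context/equiv_wsubst; exact: equiv_sym.
  have := chain_step pN pq wU cnt; rewrite -cnt.
  by move: (wsubst phi _) (wsubst phi _) => s t st; rewrite !count_cat st.
(* Ranging over all contexts and substitutions reduces products and instances in a derivation to
   single applications of identities of [Sigma]. *)
have inv (p q : free_semigroup A) : derivable Sigma p q -> forall c phi c',
    good (c ++ wsubst phi (word_of p) ++ c') <-> good (c ++ wsubst phi (word_of q) ++ c').
  elim=> {p q} [p q pqS|p|p q _ IH|p q r _ IH1 _ IH2|p q p' q' _ IH _ IH'|psi p q _ IH] c phi c'.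
  - have pq : equiv W (word_of p) (word_of q) by apply/equivP; exact: (SW_ (p, q)).
    have [/= pN qN] := HN _ pqS.
    by split; apply: step => //; exact: equiv_sym.
  - by [].
  - by split=> /IH.
  - by rewrite IH1 IH2.
  - have E (r s : free_semigroup A) : c ++ wsubst phi (word_of (r * s)%g) ++ c' =
        c ++ wsubst phi (word_of r) ++ wsubst phi (word_of s) ++ c'.
      by rewrite word_ofM wsubst_cat -catA.
    rewrite !E; apply: iff_trans (IH _ _ _) _.
    by have := IH' (c ++ wsubst phi (word_of q)) phi c'; rewrite -!catA.
  by rewrite !word_of_eval !wsubst_comp.
pose U k : free_semigroup A := (x, behead (chain_word k N)).
have UV : derivable Sigma (U n) (U n.+1).
  by apply: (SD (U n, U n.+1)); apply/equivP; exact: chain_word_equiv.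
have id_ w : [::] ++ wsubst (fun a : A => [:: a]) w ++ [::] = w.
  by rewrite cats0 /wsubst; elim: w => //= a s ->.
have [H _] := inv _ _ UV [::] (fun a => [:: a]) [::].
rewrite !id_ in H; have [] : good (chain_word n.+1 N).
  by apply: H; split; [exact: equiv_refl | exact: count_chain_x].
by rewrite count_chain_x => _ /eqP; rewrite eqn_leq ltnn.
Qed.

End Chain.

Theorem theorem4p8 (A : countType) (A_infinite : infinite_set [set: A])
    (W : set (seq A)) (m : option nat)
    (hW : forall u : seq A, W u -> adjacent_first_last u)
    (hm : is_max_power W m) :
  finitely_based A (adjoin_one A0 * SW W)%type <->
  (m = None \/
   exists n : nat, m = Some n /\
     exists d : nat, (0 < d < n + 1)%N /\
       forall (b : A) (T : seq A), T != [::] ->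
         ~ subword_in W (nseq (n + 1 - d) b ++ T ++ nseq d b)).
Proof.
have [enc enc_inj] : exists enc : nat -> A, injective enc.
  have /infiniteP/card_leP[f] := A_infinite.
  exists (fun i => val (f (SigSub (@mem_set nat setT i I)))) => i j.
  by move=> /val_inj /(in2TT 'inj_f) [].
split; last exact (finitely_based_of_condition enc_inj hW hm).
case: m hm => [n [n0 [hn maxn]] FB|]; last by left.
right; exists n; split=> //; apply: contrapT => nd.
apply: (not_finitely_based enc_inj hW n0 hn maxn _ FB) => d dn.
apply: contrapT => nbT; apply: nd; exists d; rewrite addn1; split=> // b T T0 bT.
by apply: nbT; exists b, T.
Qed.
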